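(* For every set $P \gg \emptyset''$ there exists an infinite set $C$ such that for every set $R \leq_T \emptyset'$ we have $C \subseteq^{*} R$ or $C \subseteq^{*} \overline{R}$ (i.e. $C$ is $\vec{R}$-cohesive for the (non-uniform) sequence $\vec R$ of all $\emptyset'$-computable sets), and moreover $C'' \leq_T C \oplus \emptyset'' \leq_T P$.
   Context: $A \gg B$ means that $A$ is of PA degree relative to $B$, i.e. $A$ computes a member of every nonempty $\Pi^{0,B}_1$ class of subsets of $\omega$. $X \subseteq^{*} Y$ means all but finitely many elements of $X$ belong to $Y$. $X'$ denotes the Turing jump of $X$ and $X''$ the double jump. *)

(* Defs.v *)
From Stdlib Require Import Arith Cantor.

Definition set := nat -> Prop.

Definition pr (x y : nat) : nat := Cantor.to_nat (x, y).

(* Unary oracle partial recursive programs; multi-argument functions are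
   handled through the Cantor pairing [pr]. *)
Inductive prog : Type :=
| PZero
| PSucc
| PId
| PFst
| PSnd
| POrac
| PComp (f g : prog)
| PPair (f g : prog)
| PPrim (f g : prog)
| PMu (f : prog).

Inductive eval (X : set) : prog -> nat -> nat -> Prop :=
| ev_zero x : eval X PZero x 0
| ev_succ x : eval X PSucc x (S x)
| ev_id x : eval X PId x x
| ev_fst a b : eval X PFst (pr a b) a
| ev_snd a b : eval X PSnd (pr a b) b
| ev_orac1 x : X x -> eval X POrac x 1
| ev_orac0 x : ~ X x -> eval X POrac x 0
| ev_comp f g x z y : eval X g x z -> eval X f z y -> eval X (PComp f g) x y
| ev_pair f g x a b : eval X f x a -> eval X g x b -> eval X (PPair f g) x (pr a b)
| ev_prim0 f g x y : eval X f x y -> eval X (PPrim f g) (pr x 0) y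
| ev_primS f g x n z y :
    eval X (PPrim f g) (pr x n) z -> eval X g (pr x (pr n z)) y ->
    eval X (PPrim f g) (pr x (S n)) y
| ev_mu f x n :
    eval X f (pr x n) 0 ->
    (forall m, m < n -> exists k, k <> 0 /\ eval X f (pr x m) k) ->
    eval X (PMu f) x n.

Definition halts (X : set) (p : prog) (x : nat) : Prop := exists y, eval X p x y.

Fixpoint code (p : prog) : nat :=
  match p with
  | PZero => pr 0 0
  | PSucc => pr 1 0
  | PId => pr 2 0
  | PFst => pr 3 0
  | PSnd => pr 4 0
  | POrac => pr 5 0
  | PComp f g => pr 6 (pr (code f) (code g))
  | PPair f g => pr 7 (pr (code f) (code g))
  | PPrim f g => pr 8 (pr (code f) (code g))
  | PMu f => pr 9 (code f)
  end.

Definition turing_le (A B : set) : Prop :=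
  exists p : prog, forall x, (A x -> eval B p x 1) /\ (~ A x -> eval B p x 0).

Definition emptyset : set := fun _ => False.

Definition jump (X : set) : set :=
  fun e => exists p, code p = e /\ halts X p e.

Definition join (A B : set) : set :=
  fun n => (Nat.even n = true /\ A (Nat.div2 n)) \/ (Nat.even n = false /\ B (Nat.div2 n)).

Definition compl (A : set) : set := fun n => ~ A n.

Definition infinite (A : set) : Prop := forall n, exists m, n <= m /\ A m.

Definition subset_star (X Y : set) : Prop :=
  exists N, forall x, N <= x -> X x -> Y x.

(* Pi^{0,B}_1 classes of subsets of omega are exactly the classes
   { X | Phi_p^{B (+) X}(0) diverges } for programs p. *)
Definition Pi01_class (B : set) (p : prog) : set -> Prop :=
  fun X => ~ halts (join B X) p 0.

Definition PA_rel (A B : set) : Prop :=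
  forall p : prog, (exists X, Pi01_class B p X) ->
    exists X, Pi01_class B p X /\ turing_le X A.

(* Main.v *)
(* Let [M] be a set with [M' <= 0'] whose columns contain a member of every nonempty
   Pi01 class relative to finitely many columns, and let [Q] be the analogous set over
   [0'], so that [(0' + Q)' <= 0''].  Every Delta02 set is a column of [Q], and so is a
   nonprincipal ultrafilter [p] on the columns of [M].

   Call a Sigma01 class of sets large if it contains every member of [p].  In a Mathias
   style construction, the finite part is extended and the reservoir is cut down by
   members of [p] and by columns of [Q] or their complements, so that the reservoir
   remains in all large classes.  A Sigma02 fact can be forced by passing to a member of
   [p] if some extension of the finite part makes the class of sets refuting it not
   large.  Whether there is such an extension is a Sigma01 question relative to
   [0' + Q], hence answered by [0''].  If there is none, every instance of the negated
   fact can be met inside the reservoir.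

   The only choices are the sides [g] of the columns of [Q].  The good [g] form a Pi01
   class relative to [0''], which is nonempty because a bad splitting of the numbers
   could be replaced by one coded in [M], one piece of which is in [p].  So [P] computes
   a good [g]; and [C + 0''] recovers [g] from the elements of [C]. *)
From Stdlib Require Import Arith Lia Cantor Classical ClassicalEpsilon.
From Stdlib Require Import FunctionalExtensionality PropExtensionality.
Require Import Defs.

(** * Extensionality and the pairing function *)

Lemma set_ext (A B : set) : (forall n, A n <-> B n) -> A = B.
Proof.
  intros E. apply functional_extensionality. intros n.
  now apply propositional_extensionality.
Qed.

Definition fs (n : nat) : nat := fst (Cantor.of_nat n).
Definition sn (n : nat) : nat := snd (Cantor.of_nat n).

Lemma fs_pr a b : fs (pr a b) = a.
Proof. unfold fs, pr. now rewrite Cantor.cancel_of_to. Qed.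

Lemma sn_pr a b : sn (pr a b) = b.
Proof. unfold sn, pr. now rewrite Cantor.cancel_of_to. Qed.

Lemma pr_fs_sn n : pr (fs n) (sn n) = n.
Proof.
  unfold fs, sn, pr. rewrite <- surjective_pairing. apply Cantor.cancel_to_of.
Qed.

Lemma pr_inj a b c d : pr a b = pr c d -> a = c /\ b = d.
Proof.
  intros H. split.
  - rewrite <- (fs_pr a b), <- (fs_pr c d). now f_equal.
  - rewrite <- (sn_pr a b), <- (sn_pr c d). now f_equal.
Qed.

Lemma pr_double a b : pr a b * 2 = b * 2 + (b + a) * S (b + a).
Proof. apply Cantor.to_nat_spec. Qed.

Lemma pr_ge_l a b : a <= pr a b.
Proof. pose proof (pr_double a b). nia. Qed.

Lemma pr_ge_r a b : b <= pr a b.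
Proof. pose proof (pr_double a b). nia. Qed.

Lemma pr_gt_r a b : 0 < a -> b < pr a b.
Proof. pose proof (pr_double a b). nia. Qed.

Lemma pr_mono_r a b b' : b <= b' -> pr a b <= pr a b'.
Proof. pose proof (pr_double a b). pose proof (pr_double a b'). nia. Qed.

Global Opaque pr fs sn.

(* The generated principle gives no induction hypothesis for the premises of
   [ev_mu] that sit under [exists]. *)
Lemma eval_strong_ind (X : set) (P : prog -> nat -> nat -> Prop) :
  (forall x, P PZero x 0) ->
  (forall x, P PSucc x (S x)) ->
  (forall x, P PId x x) ->
  (forall a b, P PFst (pr a b) a) ->
  (forall a b, P PSnd (pr a b) b) ->
  (forall x, X x -> P POrac x 1) ->
  (forall x, ~ X x -> P POrac x 0) ->
  (forall f g x z y, P g x z -> P f z y -> P (PComp f g) x y) ->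
  (forall f g x a b, P f x a -> P g x b -> P (PPair f g) x (pr a b)) ->
  (forall f g x y, P f x y -> P (PPrim f g) (pr x 0) y) ->
  (forall f g x n z y, P (PPrim f g) (pr x n) z -> P g (pr x (pr n z)) y ->
     P (PPrim f g) (pr x (S n)) y) ->
  (forall f x n, P f (pr x n) 0 ->
     (forall m, m < n -> exists k, k <> 0 /\ P f (pr x m) k) -> P (PMu f) x n) ->
  forall p x y, eval X p x y -> P p x y.
Proof.
  intros H0 H1 H2 H3 H4 H5 H6 H7 H8 H9 H10 H11.
  fix IH 4. intros p x y H. destruct H.
  - apply H0.
  - apply H1.
  - apply H2.
  - apply H3.
  - apply H4.
  - now apply H5.
  - now apply H6.
  - eapply H7; apply IH; eassumption.
  - apply H8; apply IH; assumption.
  - apply H9; apply IH; assumption.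
  - eapply H10; apply IH; eassumption.
  - apply H11; [now apply IH|]. intros m Hm.
    match goal with B : forall m, m < n -> exists k, k <> 0 /\ eval _ _ _ _ |- _ =>
      destruct (B m Hm) as [k [Hk E]] end.
    exists k. split; [exact Hk|]. now apply IH.
Qed.

(** * Inversion and determinism of evaluation *)

Lemma eval_prim_inv X f g u y : eval X (PPrim f g) u y ->
  (sn u = 0 /\ eval X f (fs u) y) \/
  (exists n z, sn u = S n /\ eval X (PPrim f g) (pr (fs u) n) z /\
     eval X g (pr (fs u) (pr n z)) y).
Proof.
  intros H. inversion H; subst; rewrite ?fs_pr, ?sn_pr; eauto 6.
Qed.

Lemma eval_fst_inv X u y : eval X PFst u y -> y = fs u.
Proof. intros H. inversion H. now rewrite fs_pr. Qed.

Lemma eval_snd_inv X u y : eval X PSnd u y -> y = sn u.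
Proof. intros H. inversion H. now rewrite sn_pr. Qed.

Lemma eval_functional X p x y y' : eval X p x y -> eval X p x y' -> y = y'.
Proof.
  intros H. revert y'. revert p x y H.
  refine (eval_strong_ind X (fun p x y => forall y', eval X p x y' -> y = y')
            _ _ _ _ _ _ _ _ _ _ _ _).
  1-3: intros x y' H; now inversion H.
  - intros a b y' H. apply eval_fst_inv in H. now rewrite fs_pr in H.
  - intros a b y' H. apply eval_snd_inv in H. now rewrite sn_pr in H.
  - intros x Hx y' H. inversion H; [reflexivity|contradiction].
  - intros x Hx y' H. inversion H; [contradiction|reflexivity].
  - intros f g x z y Hg Hf y' H. inversion H; subst.
    apply Hf. erewrite Hg; eassumption.
  - intros f g x a b Hf Hg y' H. inversion H; subst. f_equal; auto.
  - intros f g x y Hf y' H.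
    destruct (eval_prim_inv _ _ _ _ _ H) as [[_ E]|[n [z [E _]]]];
      rewrite ?fs_pr, ?sn_pr in E; [auto|discriminate].
  - intros f g x n z y Hf Hg y' H.
    destruct (eval_prim_inv _ _ _ _ _ H) as [[E _]|[n' [z' [E [E1 E2]]]]];
      rewrite ?fs_pr, ?sn_pr in *; [discriminate|].
    injection E as <-. apply Hg. erewrite Hf; eassumption.
  - intros f x n A B y' H. inversion H as [| | | | | | | | | | |? ? ? E C]; subst.
    destruct (lt_eq_lt_dec n y') as [[L|L]|L]; auto; exfalso.
    + destruct (C n L) as [k [Hk E']]. apply A in E'. congruence.
    + destruct (B y' L) as [k [Hk E']]. apply E' in E. congruence.
Qed.

Fixpoint const_prog (n : nat) : prog :=
  match n with 0 => PZero | S m => PComp PSucc (const_prog m) end.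

Lemma eval_const X n x : eval X (const_prog n) x n.
Proof. induction n; simpl; econstructor; eauto; constructor. Qed.

Lemma eval_fs X x : eval X PFst x (fs x).
Proof. rewrite <- (pr_fs_sn x) at 1. constructor. Qed.

Lemma eval_sn X x : eval X PSnd x (sn x).
Proof. rewrite <- (pr_fs_sn x) at 1. constructor. Qed.

(** * Functions and relations computable uniformly in a family of oracles *)

Definition chi (P : Prop) : nat := if excluded_middle_informative P then 1 else 0.

Lemma chi_true (P : Prop) : P -> chi P = 1.
Proof. unfold chi. destruct excluded_middle_informative; tauto. Qed.

Lemma chi_false (P : Prop) : ~ P -> chi P = 0.
Proof. unfold chi. destruct excluded_middle_informative; tauto. Qed.

Lemma chi_iff (P Q : Prop) : (P <-> Q) -> chi P = chi Q.
Proof. unfold chi. do 2 destruct excluded_middle_informative; tauto. Qed.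

Definition ite (n a b : nat) : nat := match n with 0 => b | S _ => a end.

(** One program serves all indices [i]. With [I := set] this describes Turing functionals, with
    [I := unit] computability from one oracle. *)
Definition cpt {I : Type} (O : I -> set) (f : I -> nat -> nat) : Prop :=
  exists p, forall i x, eval (O i) p x (f i x).

Definition dec {I : Type} (O : I -> set) (A : I -> nat -> Prop) : Prop :=
  cpt O (fun i x => chi (A i x)).

Section Toolkit.
Context {I : Type} (O : I -> set).

Lemma cpt_ext (f g : I -> nat -> nat) :
  (forall i x, f i x = g i x) -> cpt O f -> cpt O g.
Proof. intros E [p H]. exists p. intros. rewrite <- E. apply H. Qed.

Lemma dec_ext (A B : I -> nat -> Prop) :
  (forall i x, A i x <-> B i x) -> dec O A -> dec O B.
Proof. intros E. apply cpt_ext. intros. now apply chi_iff. Qed.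

Lemma cpt_id : cpt O (fun _ x => x).
Proof. exists PId. constructor. Qed.

Lemma cpt_const n : cpt O (fun _ _ => n).
Proof. exists (const_prog n). intros. apply eval_const. Qed.

Lemma cpt_comp (g f : I -> nat -> nat) :
  cpt O g -> cpt O f -> cpt O (fun i x => g i (f i x)).
Proof. intros [q Hq] [p Hp]. exists (PComp q p). intros. econstructor; eauto. Qed.

Lemma dec_comp (A : I -> nat -> Prop) (f : I -> nat -> nat) :
  dec O A -> cpt O f -> dec O (fun i x => A i (f i x)).
Proof. intros H. now apply (cpt_comp _ f H). Qed.

Lemma cpt_fs f : cpt O f -> cpt O (fun i x => fs (f i x)).
Proof. apply (cpt_comp (fun _ => fs)). exists PFst. intros. apply eval_fs. Qed.

Lemma cpt_sn f : cpt O f -> cpt O (fun i x => sn (f i x)).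
Proof. apply (cpt_comp (fun _ => sn)). exists PSnd. intros. apply eval_sn. Qed.

Lemma cpt_S f : cpt O f -> cpt O (fun i x => S (f i x)).
Proof. apply (cpt_comp (fun _ => S)). exists PSucc. constructor. Qed.

Lemma cpt_pr f g : cpt O f -> cpt O g -> cpt O (fun i x => pr (f i x) (g i x)).
Proof. intros [p Hp] [q Hq]. exists (PPair p q). intros. constructor; auto. Qed.

Lemma dec_oracle f : cpt O f -> dec O (fun i x => O i (f i x)).
Proof.
  apply (dec_comp (fun i x => O i x)). exists POrac. intros.
  destruct (classic (O i x)).
  - rewrite chi_true by auto. now constructor.
  - rewrite chi_false by auto. now constructor.
Qed.

Lemma cpt_rec (c f : I -> nat -> nat) (g : I -> nat -> nat -> nat -> nat) :
  cpt O c -> cpt O f ->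
  cpt O (fun i u => g i (fs u) (fs (sn u)) (sn (sn u))) ->
  cpt O (fun i x => nat_rect (fun _ => nat) (f i x) (fun n z => g i x n z) (c i x)).
Proof.
  intros Hc [p Hp] [q Hq].
  set (G := fun i u => nat_rect (fun _ => nat) (f i (fs u))
              (fun n z => g i (fs u) n z) (sn u)).
  apply (cpt_ext (fun i x => G i (pr x (c i x)))).
  { intros. unfold G. now rewrite fs_pr, sn_pr. }
  apply (cpt_comp G (fun i x => pr x (c i x)));
    [|apply cpt_pr; [apply cpt_id|exact Hc]].
  exists (PPrim p q). intros i u. rewrite <- (pr_fs_sn u) at 1. unfold G.
  induction (sn u) as [|n IH]; simpl.
  - now constructor.
  - econstructor; [apply IH|]. specialize (Hq i (pr (fs u) (pr n
      (nat_rect (fun _ => nat) (f i (fs u)) (fun n z => g i (fs u) n z) n)))).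
    now rewrite ?sn_pr, ?fs_pr, ?sn_pr in Hq.
Qed.

Lemma cpt_ite c f g :
  cpt O c -> cpt O f -> cpt O g -> cpt O (fun i x => ite (c i x) (f i x) (g i x)).
Proof.
  intros Hc Hf Hg.
  apply (cpt_ext (fun i x => nat_rect (fun _ => nat) (g i x)
                               (fun n z => f i x) (c i x))).
  { intros. now destruct (c i x). }
  apply (cpt_rec c g (fun i x _ _ => f i x)); auto.
  apply (cpt_comp f); auto. apply cpt_fs, cpt_id.
Qed.

Lemma cpt_pred f : cpt O f -> cpt O (fun i x => pred (f i x)).
Proof.
  intros Hf.
  apply (cpt_ext (fun i x => nat_rect (fun _ => nat) 0 (fun n z => n) (f i x))).
  { intros. now destruct (f i x). }
  apply (cpt_rec f (fun _ _ => 0) (fun _ _ n _ => n)); auto using cpt_const.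
  apply cpt_fs, cpt_sn, cpt_id.
Qed.

Lemma cpt_add f g : cpt O f -> cpt O g -> cpt O (fun i x => f i x + g i x).
Proof.
  intros Hf Hg.
  apply (cpt_ext (fun i x => nat_rect (fun _ => nat) (g i x) (fun n z => S z) (f i x))).
  { intros. induction (f i x); simpl; auto. }
  apply (cpt_rec f g (fun _ _ _ z => S z)); auto.
  apply cpt_S, cpt_sn, cpt_sn, cpt_id.
Qed.

Lemma cpt_sub f g : cpt O f -> cpt O g -> cpt O (fun i x => f i x - g i x).
Proof.
  intros Hf Hg.
  apply (cpt_ext (fun i x => nat_rect (fun _ => nat) (f i x) (fun n z => pred z) (g i x))).
  { intros. induction (g i x); simpl; lia. }
  apply (cpt_rec g f (fun _ _ _ z => pred z)); auto.
  apply cpt_pred, cpt_sn, cpt_sn, cpt_id.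
Qed.

Lemma cpt_pow2 f : cpt O f -> cpt O (fun i x => 2 ^ f i x).
Proof.
  intros Hf.
  apply (cpt_ext (fun i x => nat_rect (fun _ => nat) 1 (fun n z => z + z) (f i x))).
  { intros. induction (f i x); simpl; lia. }
  apply (cpt_rec f (fun _ _ => 1) (fun _ _ _ z => z + z)); auto using cpt_const.
  apply cpt_add; apply cpt_sn, cpt_sn, cpt_id.
Qed.

Lemma dec_lt f g : cpt O f -> cpt O g -> dec O (fun i x => f i x < g i x).
Proof.
  intros Hf Hg. apply (cpt_ext (fun i x => ite (g i x - f i x) 1 0)).
  { intros. destruct (le_lt_dec (g i x) (f i x)).
    - rewrite chi_false by lia. now replace (g i x - f i x) with 0 by lia.
    - rewrite chi_true by lia. destruct (g i x - f i x) eqn:E; [lia|easy]. }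
  apply cpt_ite; auto using cpt_const. now apply cpt_sub.
Qed.

Lemma dec_and A B : dec O A -> dec O B -> dec O (fun i x => A i x /\ B i x).
Proof.
  intros HA HB. apply (cpt_ext (fun i x => ite (chi (A i x)) (chi (B i x)) 0)).
  { intros. unfold chi. repeat destruct excluded_middle_informative; simpl; tauto. }
  apply cpt_ite; auto using cpt_const.
Qed.

Lemma dec_or A B : dec O A -> dec O B -> dec O (fun i x => A i x \/ B i x).
Proof.
  intros HA HB. apply (cpt_ext (fun i x => ite (chi (A i x)) 1 (chi (B i x)))).
  { intros. unfold chi. repeat destruct excluded_middle_informative; simpl; tauto. }
  apply cpt_ite; auto using cpt_const.
Qed.

Lemma dec_not A : dec O A -> dec O (fun i x => ~ A i x).
Proof.
  intros HA. apply (cpt_ext (fun i x => ite (chi (A i x)) 0 1)).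
  { intros. unfold chi. repeat destruct excluded_middle_informative; simpl; tauto. }
  apply cpt_ite; auto using cpt_const.
Qed.

Lemma dec_impl A B : dec O A -> dec O B -> dec O (fun i x => A i x -> B i x).
Proof.
  intros HA HB. apply (cpt_ext (fun i x => ite (chi (A i x)) (chi (B i x)) 1)).
  { intros. unfold chi. repeat destruct excluded_middle_informative; simpl; tauto. }
  apply cpt_ite; auto using cpt_const.
Qed.

Lemma dec_iff A B : dec O A -> dec O B -> dec O (fun i x => A i x <-> B i x).
Proof. intros HA HB. apply dec_and; now apply dec_impl. Qed.

Lemma dec_const (P : Prop) : dec O (fun _ _ => P).
Proof. exact (cpt_const (chi P)). Qed.

Lemma dec_le f g : cpt O f -> cpt O g -> dec O (fun i x => f i x <= g i x).
Proof.
  intros Hf Hg. apply (dec_ext (fun i x => f i x < S (g i x))).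
  { intros. lia. }
  apply dec_lt; auto using cpt_S.
Qed.

Lemma dec_eq f g : cpt O f -> cpt O g -> dec O (fun i x => f i x = g i x).
Proof.
  intros Hf Hg. apply (dec_ext (fun i x => f i x <= g i x /\ g i x <= f i x)).
  { intros. lia. }
  apply dec_and; apply dec_le; auto.
Qed.

Lemma cpt_if A f g : dec O A -> cpt O f -> cpt O g ->
  cpt O (fun i x => if excluded_middle_informative (A i x) then f i x else g i x).
Proof.
  intros HA Hf Hg. apply (cpt_ext (fun i x => ite (chi (A i x)) (f i x) (g i x))).
  { intros. unfold chi. now destruct excluded_middle_informative. }
  now apply cpt_ite.
Qed.

Lemma dec_exlt b (A : I -> nat -> nat -> Prop) :
  cpt O b -> dec O (fun i u => A i (fs u) (sn u)) ->
  dec O (fun i x => exists n, n < b i x /\ A i x n).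
Proof.
  intros Hb HA.
  (* The accumulator becomes 1 at the first [n] with [A i x n] and stays 1. *)
  apply (cpt_ext (fun i x => nat_rect (fun _ => nat) 0
                   (fun n z => ite z 1 (chi (A i x n))) (b i x))).
  { intros. induction (b i x) as [|k IH]; simpl.
    - rewrite chi_false; auto. intros [n [? _]]; lia.
    - rewrite IH. destruct (classic (exists n, n < k /\ A i x n)) as [[m [? ?]]|N].
      + rewrite (chi_true (exists n, n < k /\ _)) by eauto. simpl.
        symmetry. apply chi_true. eauto.
      + rewrite (chi_false (exists n, n < k /\ _)) by auto. simpl.
        apply chi_iff. split; [eauto|]. intros [m [? ?]].
        destruct (Nat.eq_dec m k); [congruence|].
        destruct N. exists m. split; auto. lia. }
  apply (cpt_rec b (fun _ _ => 0) (fun i x n z => ite z 1 (chi (A i x n))));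
    auto using cpt_const.
  apply cpt_ite; auto using cpt_const.
  - apply cpt_sn, cpt_sn, cpt_id.
  - set (G := fun i u => chi (A i (fs u) (sn u))).
    apply (cpt_ext (fun i u => G i (pr (fs u) (fs (sn u))))).
    { intros. unfold G. now rewrite fs_pr, sn_pr. }
    apply (cpt_comp G (fun i u => pr (fs u) (fs (sn u)))); [exact HA|].
    apply cpt_pr; apply cpt_fs; try apply cpt_sn; apply cpt_id.
Qed.

Lemma dec_alllt b (A : I -> nat -> nat -> Prop) :
  cpt O b -> dec O (fun i u => A i (fs u) (sn u)) ->
  dec O (fun i x => forall n, n < b i x -> A i x n).
Proof.
  intros Hb HA.
  apply (dec_ext (fun i x => ~ exists n, n < b i x /\ ~ A i x n)).
  { intros. split.
    - intros H n Hn. apply NNPP. intro. apply H. eauto.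
    - intros H [n [? ?]]. auto. }
  apply dec_not, dec_exlt; auto. now apply dec_not.
Qed.

(** Bit extraction is iterated halving followed by parity. *)
Lemma dec_bit f g : cpt O f -> cpt O g ->
  dec O (fun i x => Nat.testbit (f i x) (g i x) = true).
Proof.
  intros Hf Hg.
  assert (Hodd : cpt O (fun _ x => Nat.b2n (Nat.odd x))).
  { apply (cpt_ext (fun _ x => nat_rect (fun _ => nat) 0 (fun n z => 1 - z) x)).
    { intros _ x. induction x; auto. cbn [nat_rect]. rewrite IHx.
      rewrite Nat.odd_succ, <- Nat.negb_odd. now destruct (Nat.odd x). }
    apply (cpt_rec (fun _ x => x) (fun _ _ => 0) (fun _ _ _ z => 1 - z));
      auto using cpt_const, cpt_id.
    apply cpt_sub; auto using cpt_const. apply cpt_sn, cpt_sn, cpt_id. }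
  assert (Hdiv : cpt O (fun _ x => Nat.div2 x)).
  { apply (cpt_ext (fun _ x => nat_rect (fun _ => nat) 0
                      (fun n z => z + Nat.b2n (Nat.odd n)) x)).
    { intros _ x. induction x; auto. cbn [nat_rect]. rewrite IHx.
      pose proof (Nat.div2_odd x). pose proof (Nat.div2_odd (S x)).
      rewrite Nat.odd_succ, <- Nat.negb_odd in *.
      destruct (Nat.odd x); cbn [Nat.b2n negb] in *; lia. }
    apply (cpt_rec (fun _ x => x) (fun _ _ => 0)
             (fun _ _ n z => z + Nat.b2n (Nat.odd n))); auto using cpt_const, cpt_id.
    apply cpt_add; [apply cpt_sn, cpt_sn, cpt_id|].
    apply (cpt_comp (fun _ x => Nat.b2n (Nat.odd x)) (fun _ u => fs (sn u)) Hodd).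
    apply cpt_fs, cpt_sn, cpt_id. }
  assert (Hsh : cpt O (fun i x => nat_rect (fun _ => nat) (f i x)
                                    (fun _ z => Nat.div2 z) (g i x))).
  { apply (cpt_rec g f (fun _ _ _ z => Nat.div2 z)); auto.
    apply (cpt_comp (fun _ x => Nat.div2 x) (fun _ u => sn (sn u)) Hdiv).
    apply cpt_sn, cpt_sn, cpt_id. }
  eapply cpt_ext; [|exact (cpt_comp _ _ Hodd Hsh)].
  intros. cbv beta.
  assert (E : forall n m, Nat.odd (nat_rect (fun _ => nat) m (fun _ z => Nat.div2 z) n)
                     = Nat.testbit m n).
  { induction n as [|n IH]; intros; simpl; auto.
    rewrite <- IH. f_equal. clear IH.
    induction n as [|n IH]; simpl; congruence. }
  rewrite E. destruct Nat.testbit; unfold chi;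
    destruct excluded_middle_informative; simpl; congruence.
Qed.

End Toolkit.

(** * Unbounded search *)

Definition least (A : nat -> Prop) : nat :=
  epsilon (inhabits 0) (fun n => A n /\ forall m, m < n -> ~ A m).

Lemma least_spec A : (exists n, A n) -> A (least A) /\ forall m, m < least A -> ~ A m.
Proof.
  intros [n Hn]. unfold least. apply epsilon_spec.
  revert Hn. induction n as [n IH] using lt_wf_ind. intros Hn.
  destruct (classic (exists m, m < n /\ A m)) as [[m [H1 H2]]|H].
  - eauto.
  - exists n. split; auto. intros m H1 H2. apply H. eauto.
Qed.

(** [PMu] looks for the value 0, so the program under it computes the characteristic function of the
    negation of [A]. *)
Lemma eval_mu_least X p (A : nat -> Prop) x :
  (forall n, eval X p (pr x n) (chi (~ A n))) -> (exists n, A n) ->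
  eval X (PMu p) x (least A).
Proof.
  intros Hp [n Hn]. destruct (least_spec A) as [H1 H2]; [eauto|].
  constructor.
  - specialize (Hp (least A)). rewrite chi_false in Hp; auto.
  - intros m Hm. exists 1. split; auto.
    specialize (Hp m). rewrite chi_true in Hp; auto.
Qed.

Lemma dec_prog {I} (O : I -> set) (A : I -> nat -> nat -> Prop) :
  dec O (fun i u => A i (fs u) (sn u)) ->
  exists p, (forall i x n, eval (O i) p (pr x n) (chi (~ A i x n))).
Proof.
  intros HA. destruct (dec_not _ _ HA) as [p Hp]. exists p. intros.
  specialize (Hp i (pr x n)). now rewrite fs_pr, sn_pr in Hp.
Qed.

Lemma cpt_least {I} (O : I -> set) (A : I -> nat -> nat -> Prop) :
  dec O (fun i u => A i (fs u) (sn u)) -> (forall i x, exists n, A i x n) ->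
  cpt O (fun i x => least (A i x)).
Proof.
  intros HA Hex. destruct (dec_prog O A HA) as [p Hp].
  exists (PMu p). intros. apply eval_mu_least; auto.
Qed.

(** Links [dec] to [halts]: for oracles [join B X] indexed by [X], the class of all [X] without [n]
    satisfying [A X n] becomes a Pi01 class given by a program. *)
Lemma semidecidable_prog {I} (O : I -> set) (A : I -> nat -> nat -> Prop) :
  dec O (fun i u => A i (fs u) (sn u)) ->
  exists p, forall i x, halts (O i) p x <-> exists n, A i x n.
Proof.
  intros HA. destruct (dec_prog O A HA) as [p Hp].
  exists (PMu p). intros. split.
  - intros [y Hy]. inversion Hy; subst. exists y. apply NNPP. intros N.
    specialize (Hp i x y). rewrite chi_true in Hp by auto.
    eapply eval_functional in Hp; [|eassumption]. discriminate.
  - intros H. eexists. apply eval_mu_least; eauto.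
Qed.

(** * Proof search for computability along the syntax of a function *)

Ltac ct_hook := fail.

Ltac ct1 :=
  cbv beta;
  first [ assumption | ct_hook |
  lazymatch goal with
  | |- cpt _ (fun i x => x) => apply cpt_id
  | |- cpt _ (fun _ _ => ?n) => apply (cpt_const _ n)
  | |- dec _ (fun _ _ => ?P) => apply (dec_const _ P)
  | |- cpt _ (fun i x => fs (@?f i x)) => apply (cpt_fs _ f)
  | |- cpt _ (fun i x => sn (@?f i x)) => apply (cpt_sn _ f)
  | |- cpt _ (fun i x => S (@?f i x)) => apply (cpt_S _ f)
  | |- cpt _ (fun i x => pr (@?f i x) (@?g i x)) => apply (cpt_pr _ f g)
  | |- cpt _ (fun i x => pred (@?f i x)) => apply (cpt_pred _ f)
  | |- cpt _ (fun i x => @?f i x + @?g i x) => apply (cpt_add _ f g)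
  | |- cpt _ (fun i x => @?f i x - @?g i x) => apply (cpt_sub _ f g)
  | |- cpt _ (fun i x => 2 ^ @?f i x) => apply (cpt_pow2 _ f)
  | |- cpt _ (fun i x => if excluded_middle_informative (@?A i x)
                         then @?f i x else @?g i x) => apply (cpt_if _ A f g)
  | |- dec _ (fun i x => exists n, n < @?b i x /\ @?A i x n) => apply (dec_exlt _ b A)
  | |- dec _ (fun i x => forall n, n < @?b i x -> @?A i x n) => apply (dec_alllt _ b A)
  | |- dec _ (fun i x => @?f i x < @?g i x) => apply (dec_lt _ f g)
  | |- dec _ (fun i x => @?f i x <= @?g i x) => apply (dec_le _ f g)
  | |- dec _ (fun i x => @?A i x /\ @?B i x) => apply (dec_and _ A B)
  | |- dec _ (fun i x => @?A i x \/ @?B i x) => apply (dec_or _ A B)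
  | |- dec _ (fun i x => ~ @?A i x) => apply (dec_not _ A)
  | |- dec _ (fun i x => @?A i x <-> @?B i x) => apply (dec_iff _ A B)
  | |- dec _ (fun i x => Nat.testbit (@?f i x) (@?g i x) = true) => apply (dec_bit _ f g)
  | |- dec _ (fun i x => @eq nat (@?f i x) (@?g i x)) => apply (dec_eq _ f g)
  | |- dec _ (fun i x => @?A i x -> @?B i x) => apply (dec_impl _ A B)
  end ].
Ltac ct := repeat ct1.

Local Opaque cpt.

Lemma dec_comp2 {I} (O : I -> set) (R : I -> nat -> nat -> Prop) f g :
  dec O (fun i u => R i (fs u) (sn u)) -> cpt O f -> cpt O g ->
  dec O (fun i x => R i (f i x) (g i x)).
Proof.
  intros HR Hf Hg.
  apply (dec_ext O (fun i x => (fun i u => R i (fs u) (sn u)) i (pr (f i x) (g i x)))).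
  { intros. now rewrite fs_pr, sn_pr. }
  apply (dec_comp O (fun i u => R i (fs u) (sn u)) (fun i x => pr (f i x) (g i x))); ct.
Qed.

Lemma dec_comp3 {I} (O : I -> set) (R : I -> nat -> nat -> nat -> Prop) f g h :
  dec O (fun i u => R i (fs u) (fs (sn u)) (sn (sn u))) ->
  cpt O f -> cpt O g -> cpt O h ->
  dec O (fun i x => R i (f i x) (g i x) (h i x)).
Proof.
  intros HR Hf Hg Hh.
  apply (dec_ext O (fun i x => (fun i u v => R i u (fs v) (sn v)) i (f i x)
                                 (pr (g i x) (h i x)))).
  { intros. now rewrite fs_pr, sn_pr. }
  apply (dec_comp2 O (fun i u v => R i u (fs v) (sn v)) f
           (fun i x => pr (g i x) (h i x))); ct.
Qed.

Lemma cpt_comp2 {I} (O : I -> set) (R : I -> nat -> nat -> nat) f g :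
  cpt O (fun i u => R i (fs u) (sn u)) -> cpt O f -> cpt O g ->
  cpt O (fun i x => R i (f i x) (g i x)).
Proof.
  intros HR Hf Hg.
  apply (cpt_ext O (fun i x => (fun i u => R i (fs u) (sn u)) i (pr (f i x) (g i x)))).
  { intros. now rewrite fs_pr, sn_pr. }
  apply (cpt_comp O (fun i u => R i (fs u) (sn u)) (fun i x => pr (f i x) (g i x))); ct.
Qed.

Lemma cpt_comp3 {I} (O : I -> set) (R : I -> nat -> nat -> nat -> nat) f g h :
  cpt O (fun i u => R i (fs u) (fs (sn u)) (sn (sn u))) ->
  cpt O f -> cpt O g -> cpt O h ->
  cpt O (fun i x => R i (f i x) (g i x) (h i x)).
Proof.
  intros HR Hf Hg Hh.
  apply (cpt_ext O (fun i x => (fun i u v => R i u (fs v) (sn v)) i (f i x)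
                                 (pr (g i x) (h i x)))).
  { intros. now rewrite fs_pr, sn_pr. }
  apply (cpt_comp2 O (fun i u v => R i u (fs v) (sn v)) f
           (fun i x => pr (g i x) (h i x))); ct.
Qed.

(** * Turing reducibility, change of oracle, joins *)

Lemma turing_le_dec (A B : set) :
  turing_le A B <-> dec (fun _ : unit => B) (fun _ => A).
Proof.
  split; intros [p H]; exists p.
  - intros _ x. destruct (classic (A x)) as [a|a].
    + rewrite chi_true by exact a. now apply H.
    + rewrite chi_false by exact a. now apply H.
  - intros x. specialize (H tt x). split; intros a.
    + now rewrite chi_true in H.
    + now rewrite chi_false in H.
Qed.

Fixpoint subst_prog (q p : prog) : prog :=
  match p with
  | POrac => q
  | PComp f g => PComp (subst_prog q f) (subst_prog q g)
  | PPair f g => PPair (subst_prog q f) (subst_prog q g)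
  | PPrim f g => PPrim (subst_prog q f) (subst_prog q g)
  | PMu f => PMu (subst_prog q f)
  | _ => p
  end.

Lemma eval_subst_prog (Z O : set) q :
  (forall x, eval O q x (chi (Z x))) ->
  forall p x y, eval Z p x y -> eval O (subst_prog q p) x y.
Proof.
  intros Hq.
  apply (eval_strong_ind Z (fun p x y => eval O (subst_prog q p) x y));
    simpl; intros; try (econstructor; eauto; fail).
  - specialize (Hq x). now rewrite chi_true in Hq.
  - specialize (Hq x). now rewrite chi_false in Hq.
Qed.

(** Each oracle query is replaced by a call of the program that decides [Z (phi i)] from [O i]. *)
Lemma cpt_trans {I J} (Z : J -> set) (O : I -> set) (f : J -> nat -> nat) (phi : I -> J) :
  cpt Z f -> dec O (fun i => Z (phi i)) -> cpt O (fun i => f (phi i)).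
Proof.
  intros [p Hp] [q Hq]. exists (subst_prog q p). intros.
  apply eval_subst_prog with (Z := Z (phi i)); auto.
Qed.

Lemma dec_trans {I J} (Z : J -> set) (O : I -> set) (A : J -> nat -> Prop) (phi : I -> J) :
  dec Z A -> dec O (fun i => Z (phi i)) -> dec O (fun i => A (phi i)).
Proof. intros HA. now apply (cpt_trans Z O (fun j x => chi (A j x)) phi). Qed.

Lemma dec_trans_const {I J} (j : J) (Z : J -> set) (O : I -> set) (A : J -> nat -> Prop) :
  dec Z A -> dec O (fun _ => Z j) -> dec O (fun _ => A j).
Proof. apply (dec_trans Z O A (fun _ => j)). Qed.

Lemma dec_turing_le {I} (O : I -> set) (A B : set) :
  turing_le A B -> dec O (fun _ => B) -> dec O (fun _ => A).
Proof.
  intros H. apply turing_le_dec in H.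
  now apply (dec_trans_const tt (fun _ => B) O (fun _ => A)).
Qed.

Lemma dec_self {I} (O : I -> set) : dec O (fun i => O i).
Proof. apply (dec_oracle O (fun _ x => x)), cpt_id. Qed.

Lemma turing_le_trans A B C : turing_le A B -> turing_le B C -> turing_le A C.
Proof. intros H K. apply turing_le_dec in K. apply turing_le_dec.
  now apply (dec_turing_le _ A B). Qed.

Lemma cpt_div2 {I} (O : I -> set) f : cpt O f -> cpt O (fun i x => Nat.div2 (f i x)).
Proof.
  apply (cpt_comp O (fun _ => Nat.div2)).
  apply (cpt_ext O (fun _ x => nat_rect (fun _ => nat) 0
            (fun n z => if excluded_middle_informative (Nat.testbit n 0 = true)
                        then S z else z) x)).
  { intros _ x. induction x; auto. cbn [nat_rect]. rewrite IHx.
    rewrite Nat.bit0_odd.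
    pose proof (Nat.div2_odd x). pose proof (Nat.div2_odd (S x)).
    rewrite Nat.odd_succ, <- Nat.negb_odd in *.
    destruct excluded_middle_informative as [e|e]; [rewrite e in *|
      apply Bool.not_true_is_false in e; rewrite e in *];
    cbn [Nat.b2n negb] in *; lia. }
  apply (cpt_rec O (fun _ x => x) (fun _ _ => 0)
           (fun _ _ n z => if excluded_middle_informative (Nat.testbit n 0 = true)
                        then S z else z)); ct.
Qed.

Lemma dec_join {I} (O : I -> set) (A B : I -> nat -> set) f :
  dec O (fun i u => A i (fs u) (sn u)) -> dec O (fun i u => B i (fs u) (sn u)) ->
  cpt O f ->
  dec O (fun i x => join (A i x) (B i x) (f i x)).
Proof.
  intros HA HB Hf.
  apply (dec_ext O (fun i x =>
    (~ Nat.testbit (f i x) 0 = true /\ A i x (Nat.div2 (f i x))) \/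
    (Nat.testbit (f i x) 0 = true /\ B i x (Nat.div2 (f i x))))).
  { intros. unfold join. rewrite Nat.bit0_odd, <- Nat.negb_even.
    destruct (Nat.even (f i x)); simpl; intuition congruence. }
  ct.
  - apply (dec_comp2 O A (fun i x => x)); ct. now apply cpt_div2.
  - apply (dec_comp2 O B (fun i x => x)); ct. now apply cpt_div2.
Qed.

Lemma join_even A B x : join A B (x + x) <-> A x.
Proof.
  unfold join. replace (x + x) with (2 * x) by lia.
  rewrite Nat.even_even, Nat.div2_double. intuition congruence.
Qed.

Lemma join_odd A B x : join A B (S (x + x)) <-> B x.
Proof.
  unfold join. replace (S (x + x)) with (2 * x + 1) by lia.
  rewrite Nat.even_odd. replace (2 * x + 1) with (S (2 * x)) by lia.
  rewrite Nat.div2_succ_double. intuition congruence.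
Qed.

Lemma dec_join_l {I} (O : I -> set) (A B : I -> set) :
  dec O (fun i => join (A i) (B i)) -> dec O A.
Proof.
  intros H. apply (dec_ext O (fun i x => join (A i) (B i) (x + x))).
  { intros. apply join_even. }
  apply (dec_comp O (fun i => join (A i) (B i)) (fun _ x => x + x)); ct.
Qed.

Lemma dec_join_r {I} (O : I -> set) (A B : I -> set) :
  dec O (fun i => join (A i) (B i)) -> dec O B.
Proof.
  intros H. apply (dec_ext O (fun i x => join (A i) (B i) (S (x + x)))).
  { intros. apply join_odd. }
  apply (dec_comp O (fun i => join (A i) (B i)) (fun _ x => S (x + x))); ct.
Qed.

Lemma turing_le_join A B C : turing_le A C -> turing_le B C -> turing_le (join A B) C.
Proof.
  rewrite !turing_le_dec. intros.
  apply (dec_join (fun _ : unit => C) (fun _ _ => A) (fun _ _ => B) (fun _ x => x)); ct.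
  - apply (dec_comp (fun _ : unit => C) (fun _ => A) (fun _ u => sn u)); ct.
  - apply (dec_comp (fun _ : unit => C) (fun _ => B) (fun _ u => sn u)); ct.
Qed.

Lemma turing_le_join_l A B : turing_le A (join A B).
Proof. apply turing_le_dec. apply (dec_join_l _ (fun _ => A) (fun _ => B)), dec_self. Qed.

Lemma turing_le_join_r A B : turing_le B (join A B).
Proof. apply turing_le_dec. apply (dec_join_r _ (fun _ => A) (fun _ => B)), dec_self. Qed.

(** * Finite sets as numbers *)

Definition bt (D t : nat) : Prop := Nat.testbit D t = true.

Lemma dec_bt {I} (O : I -> set) f g : cpt O f -> cpt O g ->
  dec O (fun i x => bt (f i x) (g i x)).
Proof. apply dec_bit. Qed.

(** Elements lie below the canonical index, so quantifiers over a coded finite set are bounded. *)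
Lemma bt_lt D t : bt D t -> t < D.
Proof.
  unfold bt. intros H. destruct (Nat.eq_dec D 0) as [->|N].
  { now rewrite Nat.bits_0 in H. }
  pose proof (Nat.log2_lt_lin D).
  destruct (le_lt_dec t (Nat.log2 D)); [lia|].
  rewrite Nat.bits_above_log2 in H by auto. discriminate.
Qed.

Lemma bt_setbit D t u : bt (Nat.setbit D t) u <-> bt D u \/ t = u.
Proof. unfold bt. rewrite Nat.setbit_iff. tauto. Qed.

Lemma bt_lor D E u : bt (Nat.lor D E) u <-> bt D u \/ bt E u.
Proof. unfold bt. rewrite Nat.lor_spec. apply Bool.orb_true_iff. Qed.

Lemma bt_0 t : ~ bt 0 t.
Proof. unfold bt. now rewrite Nat.bits_0. Qed.

Lemma bt_ge_pow2 D n t : D < 2 ^ n -> n <= t -> ~ bt D t.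
Proof.
  intros H1 H2. unfold bt. destruct (Nat.eq_dec D 0) as [->|N].
  { now rewrite Nat.bits_0. }
  rewrite Nat.bits_above_log2; [congruence|].
  apply Nat.log2_lt_pow2; [lia|]. eapply Nat.lt_le_trans; [eassumption|].
  apply Nat.pow_le_mono_r; lia.
Qed.

Lemma bt_add_pow2 D n t : D < 2 ^ n -> (bt (D + 2 ^ n) t <-> bt D t \/ n = t).
Proof.
  intros H. rewrite Nat.add_nocarry_lxor.
  - unfold bt. rewrite Nat.lxor_spec, Nat.pow2_bits_eqb.
    destruct (Nat.eqb_spec n t) as [<-|Ne].
    + pose proof (bt_ge_pow2 D n n H (le_n n)). unfold bt in *.
      destruct (Nat.testbit D n); simpl; intuition congruence.
    + rewrite Bool.xorb_false_r. tauto.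
  - apply Nat.bits_inj_0. intros m. rewrite Nat.land_spec, Nat.pow2_bits_eqb.
    destruct (Nat.eqb_spec n m) as [<-|Ne]; [|apply Bool.andb_false_r].
    pose proof (bt_ge_pow2 D n n H (le_n n)). unfold bt in *.
    now destruct (Nat.testbit D n).
Qed.

Fixpoint res (X : set) (n : nat) : nat :=
  match n with
  | 0 => 0
  | S m => if excluded_middle_informative (X m) then res X m + 2 ^ m else res X m
  end.

Lemma res_lt X n : res X n < 2 ^ n.
Proof.
  induction n; simpl; [lia|]. destruct excluded_middle_informative; lia.
Qed.

Lemma bt_res X n t : bt (res X n) t <-> t < n /\ X t.
Proof.
  induction n; simpl.
  - split; [now intros ?%bt_0|lia].
  - destruct excluded_middle_informative as [e|e].
    + rewrite bt_add_pow2 by apply res_lt. rewrite IHn.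
      split; [intros [[? ?]| ->]; split; auto; lia|].
      intros [? ?]. destruct (Nat.eq_dec n t); auto. left. split; auto. lia.
    + rewrite IHn. split; intros [? ?]; split; auto.
      destruct (Nat.eq_dec n t); [subst; contradiction|lia].
Qed.

Lemma res_agree X Y n : (forall x, x < n -> (X x <-> Y x)) -> res X n = res Y n.
Proof.
  induction n; intros H; simpl; auto. rewrite IHn by auto.
  specialize (H n (Nat.lt_succ_diag_r n)).
  do 2 destruct excluded_middle_informative; tauto.
Qed.

Lemma cpt_res {I} (O : I -> set) (X : I -> nat -> set) f :
  dec O (fun i u => X i (fs u) (sn u)) -> cpt O f ->
  cpt O (fun i x => res (X i x) (f i x)).
Proof.
  intros HX Hf.
  apply (cpt_ext O (fun i x => nat_rect (fun _ => nat) 0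
     (fun n z => if excluded_middle_informative (X i x n) then z + 2 ^ n else z) (f i x))).
  { intros. induction (f i x); simpl; auto. now rewrite IHn. }
  apply (cpt_rec O f (fun _ _ => 0)
   (fun i x n z => if excluded_middle_informative (X i x n) then z + 2 ^ n else z)); ct.
  apply (dec_comp2 O X); ct.
Qed.

(** * A normal form for halting computations *)

Definition fact (k x y : nat) : nat := pr k (pr x y).
Definition cfact (k : nat) : nat := pr (pr 10 k) 0.

(* [just O D t]: the fact [t] follows from facts of [D] by one rule of [eval].
   Besides facts "program k maps x to y", there are facts [cfact k] saying
   that [k] is the code of a program. *)
Definition just (O : set) (D t : nat) : Prop :=
  let k := fs t in let x := fs (sn t) in let y := sn (sn t) in
  let c := fs k in let a := sn k in
  (c = 0 /\ y = 0) \/ (c = 1 /\ y = S x) \/ (c = 2 /\ y = x) \/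
  (c = 3 /\ y = fs x) \/ (c = 4 /\ y = sn x) \/
  (c = 5 /\ ((O x /\ y = 1) \/ (~ O x /\ y = 0))) \/
  (c = 6 /\ exists z, z < D /\ (bt D (fact (sn a) x z) /\ bt D (fact (fs a) z y))) \/
  (c = 7 /\ bt D (fact (fs a) x (fs y)) /\ bt D (fact (sn a) x (sn y))) \/
  (c = 8 /\ sn x = 0 /\ bt D (fact (fs a) (fs x) y)) \/
  (c = 8 /\ 0 < sn x /\ exists z, z < D /\
     (bt D (fact k (pr (fs x) (pred (sn x))) z) /\
      bt D (fact (sn a) (pr (fs x) (pr (pred (sn x)) z)) y))) \/
  (c = 9 /\ bt D (fact a (pr x y) 0) /\
     forall m, m < y -> exists z, z < D /\ (z <> 0 /\ bt D (fact a (pr x m) z))) \/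
  (c = 10 /\ let c' := fs a in let a' := sn a in
     (c' < 6 /\ a' = 0) \/
     (6 <= c' /\ c' < 9 /\ bt D (cfact (fs a')) /\ bt D (cfact (sn a'))) \/
     (c' = 9 /\ bt D (cfact a'))).

Definition valid (O : set) (D : nat) : Prop := forall t, t < D -> bt D t -> just O D t.

(** A halting witness for code [k] on input [x]. The fact [cfact k] is demanded because the leaf
    rules of [just] ignore the second component of the code, so other facts about [k] do not make it
    a genuine code. *)
Definition hw (O : set) (D k x : nat) : Prop :=
  valid O D /\ bt D (cfact k) /\ exists y, y < D /\ bt D (fact k x y).

Ltac ct_by H :=
  match type of H with
  | dec ?O (fun i u => i u) =>
    lazymatch goal with
    | |- dec O (fun i x => i (@?f i x)) => apply (dec_comp O (fun i => i) f H)
    end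
  | dec ?O (fun i u => ?W i (fs u) (fs (sn u)) (sn (sn u))) =>
    lazymatch goal with
    | |- dec O (fun i x => W i (@?f i x) (@?g i x) (@?h i x)) =>
        apply (dec_comp3 O W f g h H)
    end
  | dec ?O (fun i u => ?W i (fs u) (sn u)) =>
    lazymatch goal with
    | |- dec O (fun i x => W i (@?f i x) (@?g i x)) =>
        apply (dec_comp2 O W f g H)
    end
  | dec ?O (fun i u => ?W i u) =>
    lazymatch goal with
    | |- dec O (fun i x => W i (@?f i x)) =>
        apply (dec_comp O W f H)
    end
  | dec ?O (fun i u => ?W (fs u) (fs (sn u)) (sn (sn u))) =>
    lazymatch goal with
    | |- dec O (fun i x => W (@?f i x) (@?g i x) (@?h i x)) =>
        apply (dec_comp3 O (fun _ => W) f g h H)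
    end
  | dec ?O (fun i u => ?W (fs u) (sn u)) =>
    lazymatch goal with
    | |- dec O (fun i x => W (@?f i x) (@?g i x)) =>
        apply (dec_comp2 O (fun _ => W) f g H)
    end
  | dec ?O (fun i u => ?W u) =>
    lazymatch goal with
    | |- dec O (fun i x => W (@?f i x)) =>
        apply (dec_comp O (fun _ => W) f H)
    end
  | dec ?O (fun _ => ?W) =>
    lazymatch goal with
    | |- dec O (fun i x => W (@?f i x)) =>
        apply (dec_comp O (fun _ => W) f H)
    end
  | dec ?O ?W =>
    lazymatch goal with
    | |- dec O (fun i x => W i (@?f i x)) =>
        apply (dec_comp O W f H)
    end
  | cpt ?O (fun i u => ?W i (fs u) (fs (sn u)) (sn (sn u))) =>
    lazymatch goal with
    | |- cpt O (fun i x => W i (@?f i x) (@?g i x) (@?h i x)) =>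
        apply (cpt_comp3 O W f g h H)
    end
  | cpt ?O (fun i u => ?W i (fs u) (sn u)) =>
    lazymatch goal with
    | |- cpt O (fun i x => W i (@?f i x) (@?g i x)) =>
        apply (cpt_comp2 O W f g H)
    end
  | cpt ?O (fun i u => ?W i u) =>
    lazymatch goal with
    | |- cpt O (fun i x => W i (@?f i x)) =>
        apply (cpt_comp O W f H)
    end
  | cpt ?O (fun i u => ?W (fs u) (fs (sn u)) (sn (sn u))) =>
    lazymatch goal with
    | |- cpt O (fun i x => W (@?f i x) (@?g i x) (@?h i x)) =>
        apply (cpt_comp3 O (fun _ => W) f g h H)
    end
  | cpt ?O (fun i u => ?W (fs u) (sn u)) =>
    lazymatch goal with
    | |- cpt O (fun i x => W (@?f i x) (@?g i x)) =>
        apply (cpt_comp2 O (fun _ => W) f g H)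
    end
  | cpt ?O (fun i u => ?W u) =>
    lazymatch goal with
    | |- cpt O (fun i x => W (@?f i x)) =>
        apply (cpt_comp O (fun _ => W) f H)
    end
  | cpt ?O (fun _ => ?W) =>
    lazymatch goal with
    | |- cpt O (fun i x => W (@?f i x)) =>
        apply (cpt_comp O (fun _ => W) f H)
    end
  | cpt ?O ?W =>
    lazymatch goal with
    | |- cpt O (fun i x => W i (@?f i x)) =>
        apply (cpt_comp O W f H)
    end
  end.

Ltac ct_base := first
  [ lazymatch goal with
    | |- dec _ (fun i x => bt (@?f i x) (@?g i x)) => apply (dec_bt _ f g)
    | |- cpt _ (fun i x => Nat.div2 (@?f i x)) => apply (cpt_div2 _ f)
    | |- dec _ (fun i x => join (@?A i x) (@?B i x) (@?f i x)) => apply (dec_join _ A B f)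
    | |- cpt _ (fun i x => res (@?X i x) (@?f i x)) => apply (cpt_res _ X f)
    end
  | match goal with
    | H : dec ?O _ |- dec ?O _ => ct_by H
    | H : cpt ?O _ |- cpt ?O _ => ct_by H
    end ].
Ltac ct_hook ::= ct_base.

Lemma dec_hw {I} (O : I -> set) (W : I -> nat -> set) d k x :
  dec O (fun i u => W i (fs u) (sn u)) -> cpt O d -> cpt O k -> cpt O x ->
  dec O (fun i v => hw (W i v) (d i v) (k i v) (x i v)).
Proof.
  intros HW Hd Hk Hx. unfold hw, valid, just, fact, cfact. cbv zeta. ct.
Qed.

(** The bounds [z < D] in [just] call for [D <= E], which [sub_le] deduces from the inclusion of the
    coded sets. *)
Lemma just_mono O D E t :
  (forall u, bt D u -> bt E u) -> D <= E -> just O D t -> just O E t.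
Proof.
  intros Hs Hle. unfold just, fact, cfact. cbv zeta.
  intros H. repeat (destruct H as [H|H]); auto 8.
  - do 6 right. left. destruct H as [? [z [? [? ?]]]]. split; auto.
    exists z. split; [lia|auto].
  - do 7 right. left. intuition auto.
  - do 8 right. left. intuition auto.
  - do 9 right. left. destruct H as [? [? [z [? [? ?]]]]]. repeat split; auto.
    exists z. split; [lia|auto].
  - do 10 right. left. destruct H as [? [? H]]. repeat split; auto.
    intros m Hm. destruct (H m Hm) as [z [? [? ?]]].
    exists z. split; [lia|auto].
  - do 11 right. intuition auto.
Qed.

Lemma sub_le D E : (forall u, bt D u -> bt E u) -> D <= E.
Proof.
  intros H. assert (K : E = Nat.lor D E).
  { apply Nat.bits_inj. intros m. rewrite Nat.lor_spec. specialize (H m). unfold bt in H.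
    destruct (Nat.testbit D m), (Nat.testbit E m); simpl; auto. }
  rewrite K. destruct (Nat.eq_dec D 0) as [->|N]; [lia|].
  assert (L : Nat.ldiff D E = 0).
  { apply Nat.bits_inj_0. intros m. rewrite Nat.ldiff_spec. specialize (H m). unfold bt in
      H.
    destruct (Nat.testbit D m), (Nat.testbit E m); simpl; intuition congruence. }
  apply Nat.ldiff_le in L. lia.
Qed.

Lemma valid_mono_step O D E t :
  (forall u, bt D u -> bt E u) -> valid O D -> bt D t -> just O E t.
Proof.
  intros Hs HD Ht. apply just_mono with D; auto using sub_le. apply HD; auto.
  now apply bt_lt.
Qed.

Lemma valid_lor O D E : valid O D -> valid O E -> valid O (Nat.lor D E).
Proof.
  intros HD HE t _ Ht. apply bt_lor in Ht as [Ht|Ht].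
  - apply valid_mono_step with D; auto. intros. apply bt_lor. auto.
  - apply valid_mono_step with E; auto. intros. apply bt_lor. auto.
Qed.

Lemma valid_setbit O D t :
  valid O D -> just O D t ->
  valid O (Nat.setbit D t) /\ bt (Nat.setbit D t) t /\
  forall u, bt D u -> bt (Nat.setbit D t) u.
Proof.
  intros HD Ht. assert (Hs : forall u, bt D u -> bt (Nat.setbit D t) u).
  { intros. apply bt_setbit. auto. }
  split; [|split; auto; apply bt_setbit; auto].
  intros u _ Hu. apply bt_setbit in Hu as [Hu|<-].
  - eapply valid_mono_step; eauto.
  - eapply just_mono; eauto using sub_le.
Qed.

Definition derives (O : set) (t : nat) : Prop := exists D, valid O D /\ bt D t.

Lemma derives_just O D t : valid O D -> just O D t -> derives O t.
Proof.
  intros HD Ht. destruct (valid_setbit _ _ _ HD Ht) as [? [? _]].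
  eexists; split; eauto.
Qed.

Lemma valid_0 O : valid O 0.
Proof. intros t Ht. lia. Qed.

Lemma derives_both O t u : derives O t -> derives O u ->
  exists D, valid O D /\ bt D t /\ bt D u.
Proof.
  intros [D [? ?]] [E [? ?]]. exists (Nat.lor D E).
  split; [now apply valid_lor|]. rewrite !bt_lor. auto.
Qed.

Lemma fact_arg_lt D k x y : bt D (fact k x y) -> y < D.
Proof.
  intros H. apply bt_lt in H. unfold fact in H.
  pose proof (pr_ge_r k (pr x y)). pose proof (pr_ge_r x y). lia.
Qed.

Lemma just_leaf O D k x y a :
  k = pr a 0 ->
  (a = 0 /\ y = 0) \/ (a = 1 /\ y = S x) \/ (a = 2 /\ y = x) \/
  (a = 3 /\ y = fs x) \/ (a = 4 /\ y = sn x) \/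
  (a = 5 /\ ((O x /\ y = 1) \/ (~ O x /\ y = 0))) ->
  just O D (fact k x y).
Proof.
  intros -> H. unfold just, fact. cbv zeta. rewrite !sn_pr, !fs_pr.
  rewrite ?sn_pr, ?fs_pr. tauto.
Qed.

Ltac simpl_fact := unfold just, fact, cfact; cbv zeta;
  repeat (rewrite fs_pr || rewrite sn_pr).

Lemma derives_cfact O p : derives O (cfact (code p)).
Proof.
  induction p; simpl code;
    try (apply derives_just with 0; [apply valid_0|]; simpl_fact;
         do 11 right; split; [reflexivity|]; left; split; [lia|reflexivity]).
  - destruct (derives_both _ _ _ IHp1 IHp2) as [D [HD [? ?]]].
    apply derives_just with D; auto. simpl_fact.
    do 11 right. split; auto. right. left. unfold cfact in *. repeat split; auto; lia.
  - destruct (derives_both _ _ _ IHp1 IHp2) as [D [HD [? ?]]].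
    apply derives_just with D; auto. simpl_fact.
    do 11 right. split; auto. right. left. unfold cfact in *. repeat split; auto; lia.
  - destruct (derives_both _ _ _ IHp1 IHp2) as [D [HD [? ?]]].
    apply derives_just with D; auto. simpl_fact.
    do 11 right. split; auto. right. left. unfold cfact in *. repeat split; auto; lia.
  - destruct IHp as [D [HD ?]].
    apply derives_just with D; auto. simpl_fact.
    do 11 right. split; auto.
Qed.

Lemma derives_eval O p x y : eval O p x y -> derives O (fact (code p) x y).
Proof.
  revert p x y. apply eval_strong_ind; simpl code; intros.
  1-7: apply derives_just with 0; [apply valid_0|];
    eapply just_leaf; [reflexivity|]; rewrite ?fs_pr, ?sn_pr; tauto.
  - destruct (derives_both _ _ _ H H0) as [D [HD [H1 H2]]].
    apply derives_just with D; auto.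
    pose proof (fact_arg_lt _ _ _ _ H1). unfold fact in *. simpl_fact.
    do 6 right. left. split; auto. exists z. auto.
  - destruct (derives_both _ _ _ H H0) as [D [HD [H1 H2]]].
    apply derives_just with D; auto. unfold fact in *. simpl_fact.
    do 7 right. left. split; auto.
  - destruct H as [D [HD H]].
    apply derives_just with D; auto. unfold fact in *. simpl_fact.
    do 8 right. left. split; auto.
  - destruct (derives_both _ _ _ H H0) as [D [HD [H1 H2]]].
    apply derives_just with D; auto.
    pose proof (fact_arg_lt _ _ _ _ H1). unfold fact in *. simpl_fact.
    do 9 right. left. split; auto. split; [lia|]. exists z. auto.
  (* The nonzero values at the arguments [m < n] come with separate derivations; induction on [k]
     merges them into one finite set. *)
  - assert (K : forall k, k <= n -> exists D, valid O D /\
        forall m, m < k -> exists z, z <> 0 /\ bt D (fact (code f) (pr x m) z)).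
    { induction k as [|k IH]; intros Hk.
      - exists 0. split; [apply valid_0|]. intros; lia.
      - destruct IH as [D [HD HD']]; [lia|].
        destruct (H0 k) as [z [Hz [E [HE HE']]]]; [lia|].
        exists (Nat.lor D E). split; [now apply valid_lor|].
        intros m Hm. destruct (Nat.eq_dec m k) as [->|Ne].
        + exists z. split; auto. apply bt_lor. auto.
        + destruct (HD' m) as [z' [? ?]]; [lia|].
          exists z'. split; auto. apply bt_lor. auto. }
    destruct (K n (le_n n)) as [D [HD HD']]. destruct H as [E [HE HE']].
    apply derives_just with (Nat.lor D E); [now apply valid_lor|].
    unfold fact in *. simpl_fact.
    do 10 right. left. split; auto. split; [apply bt_lor; auto|].
    intros m Hm. destruct (HD' m Hm) as [z [? ?]].
    assert (bt (Nat.lor D E) (fact (code f) (pr x m) z)) as B by (apply bt_lor; auto).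
    exists z. split; auto. eapply fact_arg_lt; eauto.
Qed.

Lemma pr_tag_neq (c c' a a' : nat) : c <> c' -> pr c a <> pr c' a'.
Proof. intros H E. apply pr_inj in E. tauto. Qed.

Lemma code_inj p q : code p = code q -> p = q.
Proof.
  revert q. induction p; destruct q; simpl; intros H;
    try (exfalso; revert H; apply pr_tag_neq; discriminate);
    try reflexivity; apply pr_inj in H as [_ H];
    try (apply pr_inj in H as [H1 H2]); f_equal; auto.
Qed.

(** The rule for [cfact k] refers only to smaller codes, so a set of such facts cannot justify
    itself in a circle. *)
Lemma valid_cfact O D k : valid O D -> bt D (cfact k) -> exists p, code p = k.
Proof.
  intros HD. induction k as [k IH] using lt_wf_ind. intros H.
  pose proof (HD _ (bt_lt _ _ H) H) as J. revert J. simpl_fact.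
  intros J. do 11 (destruct J as [J|J]; [destruct J; discriminate|]).
  destruct J as [_ J]. rewrite <- (pr_fs_sn k). rewrite <- (pr_fs_sn k) in IH.
  destruct J as [[J1 J2]|[[J1 [J2 [J3 J4]]]|[J1 J2]]].
  - rewrite J2. destruct (fs k) as [|[|[|[|[|[|?]]]]]]; try lia;
      [exists PZero|exists PSucc|exists PId|exists PFst|exists PSnd|exists POrac];
      reflexivity.
  - assert (sn k < pr (fs k) (sn k)) as L by (apply pr_gt_r; lia).
    rewrite <- (pr_fs_sn (sn k)) in L at 1.
    destruct (IH (fs (sn k))) as [p Hp]; auto.
    { pose proof (pr_ge_l (fs (sn k)) (sn (sn k))). lia. }
    destruct (IH (sn (sn k))) as [q Hq]; auto.
    { pose proof (pr_ge_r (fs (sn k)) (sn (sn k))). lia. }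
    rewrite <- (pr_fs_sn (sn k)), <- Hp, <- Hq.
    destruct (fs k) as [|[|[|[|[|[|[|[|[|?]]]]]]]]]; try lia;
      [exists (PComp p q)|exists (PPair p q)|exists (PPrim p q)]; reflexivity.
  - destruct (IH (sn k)) as [p Hp]; auto.
    { apply pr_gt_r. lia. }
    exists (PMu p). simpl. now rewrite Hp, J1.
Qed.

(** [valid] records no order among the facts, but circular justification is impossible: a rule
    refers to subprograms or, for primitive recursion, to the same program with a smaller counter.
    Hence an induction on [p] with an inner one for [PPrim]. *)
Lemma valid_eval O D p : valid O D ->
  forall x y, bt D (fact (code p) x y) -> eval O p x y.
Proof.
  intros HD.
  assert (J : forall k x y, bt D (fact k x y) -> just O D (fact k x y)).
  { intros. apply HD; auto. now apply bt_lt. }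
  induction p; simpl code; intros x y H.
  9: { revert x H.
    assert (Q : forall n x, bt D (fact (pr 8 (pr (code p1) (code p2))) (pr x n) y) ->
      eval O (PPrim p1 p2) (pr x n) y).
    { intros n. revert y. induction n as [|n IH]; intros y x H; apply J in H;
      revert H; simpl_fact; intros H;
      repeat (destruct H as [H|H]; [try (destruct H; discriminate)|]);
      try (destruct H; discriminate).
      - constructor. apply IHp1, H.
      - destruct H as [_ [H _]]. lia.
      - destruct H as [_ [H _]]. lia.
      - destruct H as [_ [_ [z [_ [H1 H2]]]]]. cbn [pred] in *. econstructor.
        + apply IH, H1.
        + apply IHp2, H2. }
    intros x H. rewrite <- (pr_fs_sn x) in *. auto. }
  all: apply J in H; revert H; simpl_fact; intros H;
    repeat (destruct H as [H|H]; [try (destruct H; discriminate)|]);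
    try (destruct H; discriminate); destruct H as [_ H].
  - subst. constructor.
  - subst. constructor.
  - subst. constructor.
  - subst. apply eval_fs.
  - subst. apply eval_sn.
  - destruct H as [[? ->]|[? ->]]; constructor; auto.
  - destruct H as [z [_ [? ?]]]. econstructor; eauto.
  - destruct H as [H1 H2]. rewrite <- (pr_fs_sn y). constructor; auto.
  - destruct H as [H1 H2]. constructor; auto.
    intros m Hm. destruct (H2 m Hm) as [z [_ [? ?]]]. eauto.
Qed.

(** Halting as seen at stage [m]: decidable, monotone in [m], and dependent only on the oracle below
    [m]. *)
Definition hb (O : set) (m k x : nat) : Prop := exists D, D < m /\ hw O D k x.

Lemma hw_sound O D k x : hw O D k x -> exists p, code p = k /\ halts O p x.
Proof.
  intros [HD [Hc [y [_ Hy]]]]. destruct (valid_cfact _ _ _ HD Hc) as [p <-].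
  exists p. split; auto. exists y. eapply valid_eval; eauto.
Qed.

Lemma hw_complete O p x : halts O p x -> exists D, hw O D (code p) x.
Proof.
  intros [y Hy].
  destruct (derives_both _ _ _ (derives_cfact O p) (derives_eval _ _ _ _ Hy))
    as [D [HD [H1 H2]]].
  exists D. repeat split; auto. exists y. split; auto. eapply fact_arg_lt; eauto.
Qed.

Lemma halts_hb O p x : halts O p x <-> exists m, hb O m (code p) x.
Proof.
  split.
  - intros [D H]%hw_complete. exists (S D), D. split; auto.
  - intros [m [D [_ H]]]. apply hw_sound in H as [q [E H]].
    apply code_inj in E. now subst.
Qed.

Lemma jump_hw X e : jump X e <-> exists D, hw X D e e.
Proof.
  split.
  - intros [p [<- H]]. now apply hw_complete.
  - intros [D H]. now apply hw_sound in H.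
Qed.

Lemma jump_hb X e : jump X e <-> exists m, hb X m e e.
Proof.
  rewrite jump_hw. split.
  - intros [D H]. exists (S D), D. auto.
  - intros [m [D [_ H]]]. eauto.
Qed.

(** The use principle: a query occurs as a component of some fact [t < D], so it is below [D]. *)
Lemma hw_agree O O' D k x :
  (forall u, u < D -> (O u <-> O' u)) -> hw O D k x -> hw O' D k x.
Proof.
  intros HO [HD H]. split; auto. intros t Ht Hb. specialize (HD t Ht Hb).
  revert HD. unfold just. cbv zeta.
  assert (fs (sn t) < D) as L.
  { rewrite <- (pr_fs_sn t) in Ht. rewrite <- (pr_fs_sn (sn t)) in Ht.
    pose proof (pr_ge_r (fs t) (pr (fs (sn t)) (sn (sn t)))).
    pose proof (pr_ge_l (fs (sn t)) (sn (sn t))). lia. }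
  specialize (HO _ L). intros HD.
  repeat (destruct HD as [HD|HD]; [tauto|]). tauto.
Qed.

Lemma hb_agree O O' m k x :
  (forall u, u < m -> (O u <-> O' u)) -> hb O m k x -> hb O' m k x.
Proof.
  intros HO [D [HD H]]. exists D. split; auto. apply hw_agree with O; auto.
  intros. apply HO. lia.
Qed.

Lemma hb_mono O m m' k x : m <= m' -> hb O m k x -> hb O m' k x.
Proof. intros L [D [HD H]]. exists D. split; auto. lia. Qed.

Lemma dec_hb {I} (O : I -> set) (W : I -> nat -> set) m k x :
  dec O (fun i u => W i (fs u) (sn u)) -> cpt O m -> cpt O k -> cpt O x ->
  dec O (fun i v => hb (W i v) (m i v) (k i v) (x i v)).
Proof.
  intros HW Hm Hk Hx. unfold hb. apply dec_exlt; auto.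
  apply (dec_hw O (fun i u => W i (fs u)) (fun i u => sn u)); ct.
Qed.

Lemma join_agree A A' B B' m :
  (forall u, u < m -> (A u <-> A' u)) -> (forall u, u < m -> (B u <-> B' u)) ->
  forall u, u < m -> (join A B u <-> join A' B' u).
Proof.
  intros HA HB u Hu. unfold join.
  assert (Nat.div2 u < m) as L by (pose proof (Nat.div2_odd u); lia).
  specialize (HA _ L). specialize (HB _ L). tauto.
Qed.

(** * The jump *)

Lemma code_const_cpt {I} (O : I -> set) f :
  cpt O f -> cpt O (fun i x => code (const_prog (f i x))).
Proof.
  intros Hf.
  apply (cpt_ext O (fun i x => nat_rect (fun _ => nat) (code PZero)
           (fun n z => pr 6 (pr (code PSucc) z)) (f i x))).
  { intros. induction (f i x); simpl; auto. }
  apply (cpt_rec O f (fun _ _ => code PZero) (fun _ _ _ z => pr 6 (pr (code PSucc) z)));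
    ct.
Qed.

(** The parameter [x] is built into a program that ignores its own input, so running it on its own
    code answers the question about [x]. *)
Lemma dec_jump_ex {I} (O : I -> set) (A : I -> nat -> nat -> Prop) :
  dec O (fun i u => A i (fs u) (sn u)) ->
  dec (fun i => jump (O i)) (fun i x => exists n, A i x n).
Proof.
  intros HA. destruct (semidecidable_prog O A HA) as [p Hp].
  set (q := fun x => PComp p (const_prog x)).
  apply (dec_ext _ (fun i x => jump (O i) (code (q x)))).
  - intros i x. rewrite <- Hp. unfold jump, q. split.
    + intros [r [E [y H]]]. apply code_inj in E. subst.
      inversion H; subst. exists y.
      match goal with H : eval _ (const_prog x) _ ?z |- _ =>
        replace x with z; auto; eapply eval_functional; [exact H|apply eval_const]
      end.
    + intros [y H]. eexists. split; [reflexivity|]. exists y.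
      econstructor; [apply eval_const|exact H].
  - apply (dec_oracle (fun i => jump (O i)) (fun i x => code (q x))).
    unfold q. simpl. ct. apply (code_const_cpt _ (fun _ x => x)). ct.
Qed.

Lemma turing_le_jump_self A : turing_le A (jump A).
Proof.
  apply turing_le_dec.
  apply (dec_ext _ (fun _ x => exists n : nat, A x)).
  { intros. split; [intros [_ ?]; auto|]. intros; exists 0; auto. }
  apply (dec_jump_ex (fun _ : unit => A) (fun _ x _ => A x)).
  apply (dec_comp _ (fun _ => A) (fun _ u => fs u)); ct. apply (dec_self (fun _ => A)).
Qed.

(** * Compactness *)

(** Compactness of Cantor space for a decreasing sequence of nonempty clopen sets; [P m] depends
    only on the first [m] bits. *)
Lemma koenig (P : nat -> set -> Prop) :
  (forall m X Y, (forall x, x < m -> (X x <-> Y x)) -> P m X -> P m Y) ->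
  (forall m X, P (S m) X -> P m X) ->
  (forall m, exists X, P m X) ->
  exists X, forall m, P m X.
Proof.
  intros Hext Hmono Hex.
  assert (Hm : forall m m' X, m <= m' -> P m' X -> P m X).
  { intros m m' X L. induction L; auto. }
  set (good := fun k (s : set) => forall m, exists Y,
                 (forall x, x < k -> (Y x <-> s x)) /\ P m Y).
  (* The greedy path: [k] is put in whenever the result still extends to members of all levels. *)
  set (pre := fix pre k : set := match k with
     | 0 => fun _ => False
     | S k => if excluded_middle_informative (good (S k) (fun x => pre k x \/ x = k))
              then (fun x => pre k x \/ x = k) else pre k end).
  assert (Hpre : forall k x, pre k x -> x < k).
  { induction k; simpl; [tauto|]. intros x. destruct excluded_middle_informative.
    - intros [H| ->]; [specialize (IHk _ H)|]; lia.
    - intros H. specialize (IHk _ H). lia. }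
  assert (Hgood : forall k, good k (pre k)).
  { induction k.
    - intros m. destruct (Hex m) as [X HX]. exists X. split; auto. intros; lia.
    - simpl. destruct excluded_middle_informative as [e|e]; auto.
      intros m. apply not_all_ex_not in e as [m0 e].
      (* At level [m0] no extension contains [k]. A member of both levels must therefore omit [k],
         and it serves for [m]. *)
      destruct (IHk (max m m0)) as [Y [H1 H2]].
      exists Y. split; [|apply Hm with (max m m0); auto; lia].
      intros x Hx. destruct (Nat.eq_dec x k) as [->|N]; [|apply H1; lia].
      split; intros HY.
      + exfalso. apply e. exists Y. split; [|apply Hm with (max m m0); auto; lia].
        intros x Hx'. destruct (Nat.eq_dec x k) as [->|N].
        * tauto.
        * rewrite H1 by lia. tauto.
      + apply Hpre in HY. lia. }
  assert (Hst : forall k j x, x < k -> (pre (j + k) x <-> pre k x)).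
  { induction j; intros x Hx; simpl; [tauto|].
    destruct excluded_middle_informative; rewrite IHj by auto; [|tauto].
    split; [|tauto]. intros [H| ->]; auto. lia. }
  exists (fun x => pre (S x) x). intros m.
  destruct (Hgood m m) as [Y [H1 H2]].
  apply Hext with Y; auto. intros x Hx. rewrite H1 by auto.
  replace m with ((m - S x) + S x) by lia. apply Hst. lia.
Qed.

(** * Low sets *)

Lemma res_bits X m : exists s, s < 2 ^ m /\ forall x, x < m -> (bt s x <-> X x).
Proof.
  exists (res X m). split; [apply res_lt|]. intros. rewrite bt_res. tauto.
Qed.

Section LowBasis.
Variables (B : set) (A : set -> nat -> Prop).
Hypothesis (HA : dec (fun X => join B X) A) (Hne : exists X, forall n, ~ A X n).

(** The low basis theorem: [jump B] decides the jump of [join B X] bit by bit, preferring divergence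
    whenever the class shrunk so far allows it. *)
Lemma low_basis :
  exists X, (forall n, ~ A X n) /\ turing_le (jump (join B X)) (jump B).
Proof.
  destruct (semidecidable_prog (fun X => join B X) (fun X _ n => A X n)) as [q Hq].
  { ct. }
  (* [X] is expelled by stage [m] if it is seen to leave the class, or if an index [i < e] marked in
     [b] as diverging is seen to halt. *)
  set (bad := fun (X : set) m e b => hb (join B X) m (code q) 0 \/
                 exists i, i < e /\ (bt b i /\ hb (join B X) m i i)).
  assert (bad_agree : forall X Y m e b, (forall x, x < m -> (X x <-> Y x)) ->
            bad X m e b -> bad Y m e b).
  { intros X Y m e b H.
    assert (K : forall k x, hb (join B X) m k x -> hb (join B Y) m k x).
    { intros. apply hb_agree with (join B X); auto.
      apply join_agree; auto. tauto. }
    intros [H1|[i [? [? ?]]]]; [left; auto|right; eauto]. }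
  assert (bad_mono : forall X m m' e e' b b', m <= m' -> e <= e' ->
            (forall i, i < e -> bt b i -> bt b' i) -> bad X m e b -> bad X m' e' b').
  { intros X m m' e e' b b' Hm He Hb [H|[i [Hi [H1 H2]]]].
    - left. now apply hb_mono with m.
    - right. exists i. split; [lia|]. split; auto. now apply hb_mono with m. }
  set (good := fun e b => exists X, forall m, ~ bad X m e b).
  (* By compactness an empty class is exposed at a finite level, so [good] is decidable from
     [jump B]. *)
  assert (good_iff : forall e b,
    good e b <-> ~ exists m, forall s, s < 2 ^ m -> bad (bt s) m e b).
  { intros e b. split.
    - intros [X HX] [m Hm]. destruct (res_bits X m) as [s [Hs Hsx]].
      apply (HX m). apply bad_agree with (bt s); auto.
    - intros H. apply (koenig (fun m X => ~ bad X m e b)).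
      + intros m X Y E N K. apply N. apply bad_agree with Y; auto.
        intros. symmetry. auto.
      + intros m X N K. apply N. apply bad_mono with m e b; auto.
      + intros m. apply NNPP. intros N. apply H. exists m. intros s Hs.
        apply NNPP. intros N'. eauto. }
  assert (good_dec : dec (fun _ : unit => jump B) (fun _ u => good (fs u) (sn u))).
  { apply (dec_ext _ (fun _ u => ~ exists m, forall s, s < 2 ^ m ->
                                   bad (bt s) m (fs u) (sn u))).
    { intros. symmetry. apply good_iff. }
    apply dec_not.
    apply (dec_jump_ex (fun _ : unit => B)
      (fun _ u m => forall s, s < 2 ^ m -> bad (bt s) m (fs u) (sn u))).
    assert (HB : dec (fun _ : unit => B) (fun _ => B)) by apply (dec_self (fun _ => B)).
    unfold bad. ct.
    - apply (dec_hb _ (fun _ u => join B (bt (sn u)))); ct.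
    - apply (dec_hb _ (fun _ u => join B (bt (sn (fs u))))); ct. }
  (* Bit [e] promises divergence of index [e], given exactly when this is consistent with the
     earlier promises. *)
  set (b := fun e => nat_rect (fun _ => nat) 0
     (fun e b => if excluded_middle_informative (good (S e) (b + 2 ^ e))
                 then b + 2 ^ e else b) e).
  assert (b_cpt : cpt (fun _ : unit => jump B) (fun _ e => b e)).
  { apply (cpt_rec _ (fun _ e => e) (fun _ _ => 0)
     (fun _ _ e b => if excluded_middle_informative (good (S e) (b + 2 ^ e))
                 then b + 2 ^ e else b)); ct. }
  assert (b_lt : forall e, b e < 2 ^ e).
  { induction e; simpl; [lia|]. destruct excluded_middle_informative; fold (b e); lia. }
  assert (b_S : forall e i, i < e -> (bt (b (S e)) i <-> bt (b e) i)).
  { intros e i Hi. simpl. fold (b e). destruct excluded_middle_informative; [|tauto].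
    rewrite bt_add_pow2 by auto. intuition lia. }
  assert (b_le : forall d e i, i < e -> (bt (b (d + e)) i <-> bt (b e) i)).
  { induction d; intros e i Hi; [tauto|]. simpl plus. rewrite b_S by lia. auto. }
  assert (b_good : forall e, good e (b e)).
  { induction e.
    - destruct Hne as [X HX]. exists X. intros m [H|[i [H _]]]; [|lia].
      assert (halts (join B X) q 0) as K by (apply halts_hb; eauto).
      apply Hq in K as [n Hn]. now apply (HX n).
    - simpl. destruct excluded_middle_informative as [e0|e0]; fold (b e) in *; auto.
      destruct IHe as [X HX]. exists X. intros m [H|[i [H1 [H2 H3]]]].
      + apply (HX m). now left.
      + apply (HX m). right. exists i. split; auto.
        destruct (Nat.eq_dec i e) as [->|]; [|lia].
        exfalso. eapply bt_ge_pow2; [apply (b_lt e)|apply le_n|exact H2]. }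
  (* Compactness again: one set keeps all promises. *)
  destruct (koenig (fun m X => ~ bad X m m (b m))) as [X HX].
  { intros m X Y E N K. apply N. apply bad_agree with Y; auto.
    intros. symmetry. auto. }
  { intros m X N K. apply N. apply bad_mono with m m (b m); auto.
    intros. now apply b_S. }
  { intros m. destruct (b_good m) as [X HX]. eauto. }
  exists X. split.
  - intros n Hn. assert (halts (join B X) q 0) as K by (apply Hq; eauto).
    apply halts_hb in K as [m K]. apply (HX m). now left.
  - apply turing_le_dec. apply (dec_ext _ (fun _ i => ~ bt (b (S i)) i)).
    2: { apply dec_not. apply dec_bt; ct. }
    intros _ i. rewrite jump_hb. split.
    + intros N. simpl in N. fold (b i) in N.
      destruct excluded_middle_informative as [e|e].
      { destruct N. apply bt_add_pow2; auto. }
      (* Without a promise for [i], every set is bad once [i] is marked. As [X] keeps the earlier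
         promises, it is bad through [i], that is, [i] is in the jump. *)
      rewrite good_iff in e. apply NNPP in e as [m Hm].
      destruct (res_bits X m) as [s [Hs Hsx]].
      specialize (Hm s Hs). apply bad_agree with (Y := X) in Hm; auto.
      destruct Hm as [Hm|[j [Hj [H1 H2]]]].
      * exfalso. apply (HX m). now left.
      * apply bt_add_pow2 in H1 as [H1| <-]; [|eauto|apply b_lt].
        assert (j < i) as L.
        { destruct (le_lt_dec i j); auto. exfalso.
          apply bt_ge_pow2 with (n := i) in H1; auto. }
        exfalso. apply (HX (m + i)). right. exists j. split; [lia|].
        split; [now apply b_le|]. apply hb_mono with m; auto. lia.
    + intros [m Hm] H. apply (HX (m + S i)). right. exists i. split; [lia|].
      split; [apply b_le; auto|]. apply hb_mono with m; auto. lia.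
Qed.
End LowBasis.

Definition col (M : set) (c : nat) : set := fun x => M (pr c x).
Definition below (M : set) (c : nat) : set := fun y => fs y < c /\ M y.

(* Column [c] of a suitable [M] lies in the class given by the program with code
   [fs c], relative to the oracle [B], the columns before [c], and the set itself. *)
Lemma low_closed_set (B : set) :
  exists M, turing_le (jump (join B M)) (jump B) /\
    forall (A : set * set -> nat -> Prop),
      dec (fun SF => join B (join (fst SF) (snd SF))) A ->
      forall N, (forall c, N <= c -> exists F, forall n, ~ A (below M c, F) n) ->
      exists c, N <= c /\ forall n, ~ A (below M c, col M c) n.
Proof.
  set (G := fun Z F k m => hb (join B (join Z F)) m k 0).
  assert (G_agree : forall Z F F' k m, (forall x, x < m -> (F x <-> F' x)) ->
            G Z F k m -> G Z F' k m).
  { intros Z F F' k m H. unfold G. apply hb_agree.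
    apply join_agree; [tauto|]. apply join_agree; [tauto|auto]. }
  assert (G_mono : forall Z F k m m', m <= m' -> G Z F k m -> G Z F k m').
  { intros. now apply hb_mono with m. }
  (* The class to be met: column [c] may be refuted at stage [m] only if all strings of length [m]
     are. This can be obeyed even when the class attached to [c] is empty, so a single Pi01 class
     handles all columns. *)
  set (A0 := fun M u => (exists s, s < 2 ^ sn u /\
                 ~ G (below M (fs u)) (bt s) (fs (fs u)) (sn u)) /\
               G (below M (fs u)) (col M (fs u)) (fs (fs u)) (sn u)).
  destruct (low_basis B A0) as [M [HM Mlow]].
  - assert (HB : dec (fun X => join B X) (fun _ => B)).
    { apply (dec_join_l _ (fun _ => B) (fun X => X)), dec_self. }
    assert (HX : dec (fun X => join B X) (fun X x => X x)).
    { apply (dec_join_r _ (fun _ => B) (fun X => X)), dec_self. }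
    unfold A0, G. ct.
    + apply (dec_hb _ (fun M u => join B (join (below M (fs (fs u))) (bt (sn u)))));
        unfold below; ct.
    + apply (dec_hb _ (fun M u => join B (join (below M (fs u)) (col M (fs u)))));
        unfold below, col; ct.
  - assert (HF : forall Z k, exists F, forall m,
               (exists s, s < 2 ^ m /\ ~ G Z (bt s) k m) -> ~ G Z F k m).
    { intros Z k. destruct (classic (forall m, exists s, s < 2 ^ m /\ ~ G Z (bt s) k m))
        as [H|H].
      - destruct (koenig (fun m F => ~ G Z F k m)) as [F HF].
        + intros m X Y E N K. apply N. apply G_agree with Y; auto.
          intros. symmetry. auto.
        + intros m X N K. apply N. apply G_mono with m; auto.
        + intros m. destruct (H m) as [s [_ Hs]]. eauto.
        + eauto.
      (* For an empty class, take a string surviving the last level that has survivors; later levels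
         demand nothing. *)
      - apply not_all_ex_not in H. destruct (least_spec _ H) as [H1 H2].
        destruct (least (fun m => ~ exists s, s < 2 ^ m /\ ~ G Z (bt s) k m)) as [|m].
        + exists (fun _ => False). intros m [s [Hs Ns]] K. apply H1.
          exists 0. split; [simpl; lia|]. intros K'.
          apply Ns. apply G_mono with 0; [lia|]. eapply G_agree; [|exact K'].
          intros; lia.
        + specialize (H2 m (Nat.lt_succ_diag_r m)). apply NNPP in H2 as [s [_ Hs]].
          exists (bt s). intros m' [s' [Hs' Ns']] K.
          destruct (le_lt_dec m' m) as [L|L].
          * apply Hs. now apply G_mono with m'.
          * apply H1. destruct (res_bits (bt s') (S m)) as [r [Hr Hr']].
            exists r. split; auto. intros K'. apply Ns'.
            apply G_mono with (S m); auto. apply G_agree with (bt r); auto. }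
    set (F := fun Z k => epsilon (inhabits (fun _ => False))
                (fun F => forall m, (exists s, s < 2 ^ m /\ ~ G Z (bt s) k m) ->
                                    ~ G Z F k m)).
    assert (HF' : forall Z k m, (exists s, s < 2 ^ m /\ ~ G Z (bt s) k m) ->
                                    ~ G Z (F Z k) k m).
    { intros Z k. unfold F. apply epsilon_spec, HF. }
    (* The columns are chosen in order, since the class for column [c] depends on the columns before
       it. *)
    set (T := fix T c : set := match c with 0 => fun _ => False
              | S c => fun y => T c y \/ (fs y = c /\ F (T c) (fs c) (sn y)) end).
    assert (T_lt : forall c y, T c y -> fs y < c).
    { induction c; simpl; [tauto|]. intros y [H|[H _]]; [apply IHc in H|]; lia. }
    assert (T_st : forall d c y, fs y < c -> (T (d + c) y <-> T c y)).
    { induction d; intros c y H; simpl; [tauto|]. rewrite IHd by auto.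
      intuition lia. }
    set (M := fun y => T (S (fs y)) y).
    assert (E1 : forall c, below M c = T c).
    { intros c. apply set_ext. intros y. unfold below, M. split.
      - intros [H1 H2]. replace c with ((c - S (fs y)) + S (fs y)) by lia.
        apply T_st; auto.
      - intros H. pose proof (T_lt _ _ H). split; auto.
        replace c with ((c - S (fs y)) + S (fs y)) in H by lia.
        apply T_st in H; auto. }
    assert (E2 : forall c, col M c = F (T c) (fs c)).
    { intros c. apply set_ext. intros x. unfold col, M. rewrite fs_pr. simpl.
      rewrite fs_pr, sn_pr. split; [|auto]. intros [H|[_ H]]; auto.
      apply T_lt in H. rewrite fs_pr in H. lia. }
    exists M. intros n [H1 H2]. rewrite E1, E2 in H2. rewrite E1 in H1.
    revert H2. now apply HF'.
  - exists M. split; auto. intros A HA N Hex.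
    destruct (semidecidable_prog (fun SF : set * set => join B (join (fst SF) (snd SF)))
                (fun SF _ n => A SF n)) as [q Hq]; [ct|].
    (* Every program is attached to arbitrarily late columns. *)
    assert (exists c, N <= c /\ fs c = code q) as [c [Hc Ec]].
    { exists (pr (code q) N). split; [apply pr_ge_r|apply fs_pr]. }
    exists c. split; auto.
    intros n Hn. destruct (Hex c Hc) as [F HF].
    assert (halts (join B (join (below M c) (col M c))) q 0) as K.
    { apply (Hq (below M c, col M c)). eauto. }
    apply halts_hb in K as [m K]. apply (HM (pr c m)). unfold A0.
    rewrite fs_pr, sn_pr, Ec. split; [|exact K].
    destruct (res_bits F m) as [s [Hs Hs']]. exists s. split; auto.
    intros K'. assert (halts (join B (join (below M c) F)) q 0) as L.
    { apply halts_hb. exists m. eapply G_agree; [exact Hs'|exact K']. }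
    apply (Hq (below M c, F)) in L as [n' L]. now apply (HF n').
Qed.

(** * Refuting double jump facts *)

Definition jump_at (G : set) (l : nat) : set := fun x => hb G l x x.

(** Index 0 stands for finiteness, with [z] claimed as a strict bound. A positive index [e] stands
    for membership of [pred e] in the double jump, where [fs z] is claimed to be a halting witness
    that is confirmed at all stages from [sn z] on. Only the part of [G] below [l] is inspected. *)
Definition refutes (e z l : nat) (G : set) : Prop :=
  (e = 0 /\ exists x, x < l /\ (z <= x /\ G x)) \/
  (0 < e /\ exists l', l' < S l /\
     (sn z <= l' /\ ~ hw (jump_at G l') (fs z) (pred e) (pred e))).

Lemma refutes_agree e z l G G' :
  (forall x, x < l -> (G x <-> G' x)) -> refutes e z l G -> refutes e z l G'.
Proof.
  intros H [[-> [x [? [? ?]]]]|[He [l' [? [? N]]]]].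
  - left. split; auto. exists x. rewrite <- H; auto.
  - right. split; auto. exists l'. repeat split; auto. intros K. apply N.
    revert K. apply hw_agree. intros u _. unfold jump_at.
    split; apply hb_agree; intros; [symmetry|]; apply H; lia.
Qed.

Lemma refutes_mono e z l l' G : l <= l' -> refutes e z l G -> refutes e z l' G.
Proof.
  intros H [[-> [x [? ?]]]|[He [k [? ?]]]]; [left|right]; split; auto.
  - exists x. split; auto. lia.
  - exists k. split; auto. lia.
Qed.

Lemma jump_at_limit G n : exists m, forall l, m <= l -> forall x, x < n ->
  (jump_at G l x <-> jump G x).
Proof.
  induction n as [|n [m Hm]].
  - exists 0. intros; lia.
  - destruct (classic (jump G n)) as [J|J].
    + pose proof J as J'. apply jump_hb in J' as [k Hk].
      exists (m + k). intros l Hl x Hx. destruct (Nat.eq_dec x n) as [->|].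
      * split; auto. intros _. apply hb_mono with k; auto. lia.
      * apply Hm; lia.
    + exists m. intros l Hl x Hx. destruct (Nat.eq_dec x n) as [->|].
      * split; [|tauto]. intros K. apply jump_hb. exists l. exact K.
      * apply Hm; lia.
Qed.

(** A halting witness consults finitely many values of the jump, and [jump_at] settles on these from
    some stage on. *)
Lemma jump_jump_refutes C e : jump (jump C) e <-> exists z, forall l, ~ refutes (S e) z l C.
Proof.
  rewrite jump_hw. split.
  - intros [D HD]. destruct (jump_at_limit C D) as [m Hm].
    exists (pr D m). intros l [[? _]|[_ [l' [_ [H1 H2]]]]]; [discriminate|].
    rewrite fs_pr, sn_pr in *. cbn [pred] in *. apply H2.
    revert HD. apply hw_agree. intros u Hu. symmetry. now apply Hm.
  - intros [z Hz]. exists (fs z). destruct (jump_at_limit C (fs z)) as [m Hm].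
    apply NNPP. intros N. apply (Hz (m + sn z)). right. split; [lia|].
    exists (m + sn z). split; [lia|]. split; [lia|]. cbn [pred]. intros K. apply N.
    revert K. apply hw_agree. intros u Hu. apply Hm; lia.
Qed.

Lemma dec_refutes {I} (O : I -> set) (W : I -> nat -> set) e z l :
  dec O (fun i u => W i (fs u) (sn u)) -> cpt O e -> cpt O z -> cpt O l ->
  dec O (fun i v => refutes (e i v) (z i v) (l i v) (W i v)).
Proof.
  intros HW He Hz Hl. unfold refutes. ct.
  apply (dec_hw O (fun i u => jump_at (W i (fs u)) (sn u))); ct.
  unfold jump_at.
  apply (dec_hb O (fun i u => W i (fs (fs u)))); ct.
Qed.

(** A condition [c] codes an initial segment, with length [fs c] and bits [sn c]. New elements come
    from [Z]. *)
Definition extends (c w : nat) (Z : set) : Prop :=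
  fs c <= fs w /\ (forall x, x < fs c -> (bt (sn w) x <-> bt (sn c) x)) /\
  forall x, x < fs w -> (fs c <= x -> bt (sn w) x -> Z x).

Lemma extends_refl c Z : extends c c Z.
Proof. repeat split; auto. intros; lia. Qed.

Lemma extends_trans c d e Z : extends c d Z -> extends d e Z -> extends c e Z.
Proof.
  intros [A1 [A2 A3]] [B1 [B2 B3]]. split; [lia|]. split.
  - intros x Hx. rewrite B2 by lia. auto.
  - intros x Hx Hc Hb. destruct (le_lt_dec (fs d) x); auto.
    apply A3; auto. apply B2; auto.
Qed.

Lemma extends_mono c d (Z Z' : set) : (forall x, Z x -> Z' x) -> extends c d Z -> extends c
    d Z'.
Proof. intros H [A1 [A2 A3]]. repeat split; auto; apply A2; auto. Qed.

Lemma dec_extends {I} (O : I -> set) (W : I -> nat -> set) c w :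
  dec O (fun i u => W i (fs u) (sn u)) -> cpt O c -> cpt O w ->
  dec O (fun i v => extends (c i v) (w i v) (W i v)).
Proof. intros HW Hc Hw. unfold extends. ct. Qed.

(* For [a] coding [(c, e, z)]: some extension of [c] by elements of [Z] refutes [z]
   as a witness for [e]. *)
Definition refutable (a : nat) (Z : set) : Prop :=
  exists w, extends (fs a) w Z /\ refutes (fs (sn a)) (sn (sn a)) (fs w) (bt (sn w)).

Lemma refutable_mono a (Z Z' : set) : (forall x, Z x -> Z' x) -> refutable a Z -> refutable
    a Z'.
Proof. intros H [w [H1 H2]]. exists w. split; auto. now apply extends_mono with Z. Qed.

Lemma dec_refutable_matrix {I} (O : I -> set) (W : I -> nat -> set) a w :
  dec O (fun i u => W i (fs u) (sn u)) -> cpt O a -> cpt O w ->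
  dec O (fun i v => extends (fs (a i v)) (w i v) (W i v) /\
                    refutes (fs (sn (a i v))) (sn (sn (a i v))) (fs (w i v)) (bt (sn (w i
                        v)))).
Proof.
  intros HW Ha Hw. apply dec_and; [apply dec_extends; ct|].
  apply (dec_refutes O (fun i v => bt (sn (w i v)))); ct.
Qed.

(** Finitely many values can be built into a program, so noneffective choices for finitely many
    indices do no harm. *)
Lemma cpt_table {I} (O : I -> set) (f : nat -> nat) K :
  exists f', cpt O (fun _ x => f' x) /\ forall x, x < K -> f' x = f x.
Proof.
  induction K as [|K [f' [Hf E]]].
  - exists (fun _ => 0). split; [ct|]. intros; lia.
  - exists (fun x => if excluded_middle_informative (x = K) then f K else f' x).
    split; [ct|]. intros x Hx. destruct excluded_middle_informative; [congruence|].
    apply E. lia.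
Qed.

(** * The construction *)

Notation J1 := (jump emptyset).
Notation J2 := (jump (jump emptyset)).

Section Construction.

Variables M Q : set.
Hypothesis M_low : turing_le (jump (join emptyset M)) J1.
Hypothesis M_closed : forall (A : set * set -> nat -> Prop),
  dec (fun SF => join emptyset (join (fst SF) (snd SF))) A ->
  forall N, (forall c, N <= c -> exists F, forall n, ~ A (below M c, F) n) ->
  exists c, N <= c /\ forall n, ~ A (below M c, col M c) n.
Hypothesis Q_low : turing_le (jump (join J1 Q)) J2.
Hypothesis Q_closed : forall (A : set * set -> nat -> Prop),
  dec (fun SF => join J1 (join (fst SF) (snd SF))) A ->
  forall N, (forall c, N <= c -> exists F, forall n, ~ A (below Q c, F) n) ->
  exists c, N <= c /\ forall n, ~ A (below Q c, col Q c) n.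

(** * Columns of [Q] and the ultrafilter *)

Lemma dec_pair_oracles (B : set) :
  let O := fun SF : set * set => join B (join (fst SF) (snd SF)) in
  dec O (fun _ => B) /\ dec O (fun SF x => fst SF x) /\ dec O (fun SF x => snd SF x).
Proof.
  intros O. pose proof (dec_self O) as H.
  pose proof (dec_join_l O (fun _ => B) (fun SF => join (fst SF) (snd SF)) H).
  apply (dec_join_r O (fun _ => B) (fun SF => join (fst SF) (snd SF))) in H.
  split; auto. split.
  - apply (dec_join_l O (fun SF => fst SF) (fun SF => snd SF) H).
  - apply (dec_join_r O (fun SF => fst SF) (fun SF => snd SF) H).
Qed.

(** The singleton of [R] is a Pi01 class relative to [J1]. *)
Lemma Q_columns R : turing_le R J1 -> exists c, col Q c = R.
Proof.
  intros HR. destruct (dec_pair_oracles J1) as [H1 [_ H3]].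
  destruct (Q_closed (fun SF n => ~ (snd SF n <-> R n))) with (N := 0) as [c [_ Hc]].
  - apply (dec_turing_le _ _ _ HR) in H1. ct.
  - intros c _. exists R. intros n H. apply H. tauto.
  - exists c. apply set_ext. intros n. apply NNPP. apply Hc.
Qed.

(** Index [j] names column [sn j] of column [fs j] of [M], so that one column of [M] can code a
    whole splitting. [cell n q] is the atom with pattern [q] generated by the first [n] of these
    sets. *)
Definition cell (n q x : nat) : Prop :=
  forall j, j < n -> (M (pr (fs j) (pr (sn j) x)) <-> bt q j).

Lemma cell_res n p x :
  cell n (res p n) x <-> forall j, j < n -> (M (pr (fs j) (pr (sn j) x)) <-> p j).
Proof.
  unfold cell. split; intros H j Hj; rewrite H by auto; rewrite bt_res; tauto.
Qed.

Lemma dec_M : dec (fun _ : unit => join emptyset M) (fun _ => M).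
Proof. apply turing_le_dec, turing_le_join_r. Qed.

Lemma dec_J1_ex (A : nat -> nat -> Prop) :
  dec (fun _ : unit => join emptyset M) (fun _ u => A (fs u) (sn u)) ->
  dec (fun _ : unit => J1) (fun _ x => exists n, A x n).
Proof.
  intros H. apply (dec_jump_ex _ (fun _ => A)) in H.
  apply (dec_trans_const tt _ _ _ H). now apply turing_le_dec.
Qed.

(** [p] records which of the sets indexed by [j] lie in the ultrafilter. Since [M] is low, [J1]
    decides whether a cell has an element beyond [k], so the suitable [p] form a Pi01 class relative
    to [J1]. *)
Lemma ultrafilter_exists : exists p, (exists c, p = col Q c) /\
  forall n k, exists x, k <= x /\ cell n (res p n) x.
Proof.
  destruct (dec_pair_oracles J1) as [H1 [_ H3]].
  set (inf := fun n q k => exists x, k <= x /\ cell n q x).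
  assert (Hinf : dec (fun _ : unit => J1)
                   (fun _ u => inf (fs u) (fs (sn u)) (sn (sn u)))).
  { unfold inf. pose proof dec_M. apply (dec_J1_ex
      (fun u x => sn (sn u) <= x /\ cell (fs u) (fs (sn u)) x)). unfold cell. ct. }
  destruct (Q_closed (fun SF u => ~ inf (fs u) (res (snd SF) (fs u)) (sn u)))
    with (N := 0) as [c [_ Hc]].
  - pose proof (dec_trans_const tt _ _ _ Hinf H1) as H. cbv beta in H. ct.
  - intros c _.
    destruct (koenig (fun m X => forall k, inf m (res X m) k)) as [F HF].
    + intros m X X' E H k. rewrite <- (res_agree _ _ _ E). auto.
    + intros m X H k. destruct (H k) as [x [Hx HY]]. exists x. split; auto.
      rewrite cell_res in *. intros j Hj. apply HY. lia.
    + induction m as [|m [X HX]].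
      * exists (fun _ => False). intros k. exists k. split; auto. intros j Hj. lia.
      * set (ext := fun b : Prop => fun x => (x < m /\ X x) \/ (x = m /\ b)).
        apply NNPP. intros N.
        assert (K : forall b : Prop, exists k, ~ inf (S m) (res (ext b) (S m)) k).
        { intros b. apply NNPP. intros K. apply N. exists (ext b). intros k.
          apply NNPP. eauto. }
        destruct (K True) as [k1 K1], (K False) as [k2 K2].
        (* If both refinements of the cell stop, at [k1] and [k2], an element of the unbounded cell
           beyond both still lies in one of them. *)
        destruct (HX (k1 + k2)) as [x [Hx HY]]. rewrite cell_res in HY.
        destruct (classic (M (pr (fs m) (pr (sn m) x)))) as [B|B].
        -- apply K1. exists x. split; [lia|]. rewrite cell_res. intros j Hj.
           unfold ext. destruct (Nat.eq_dec j m) as [->|]; [tauto|].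
           rewrite HY by lia. intuition lia.
        -- apply K2. exists x. split; [lia|]. rewrite cell_res. intros j Hj.
           unfold ext. destruct (Nat.eq_dec j m) as [->|]; [intuition lia|].
           rewrite HY by lia. intuition lia.
    + exists F. intros u H. apply H, HF.
  - exists (col Q c). split; eauto. intros n k.
    specialize (Hc (pr n k)). rewrite fs_pr, sn_pr in Hc. now apply NNPP.
Qed.

Variable p : set.
Hypothesis p_col : exists c, p = col Q c.
Hypothesis p_inf : forall n k, exists x, k <= x /\ cell n (res p n) x.

Notation pcell n := (cell n (res p n)).

Lemma pcell_mono n n' x : n <= n' -> pcell n' x -> pcell n x.
Proof. rewrite !cell_res. intros L H j Hj. apply H. lia. Qed.

(** * Reservoirs, large classes and the complexity of the questions about them *)

Definition guided (s h x : nat) : Prop := forall j, j < s -> (Q (pr j x) <-> bt h j).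

Lemma guided_res s g x : guided s (res g s) x <-> forall j, j < s -> (Q (pr j x) <-> g j).
Proof.
  unfold guided. split; intros H j Hj; rewrite H by auto; rewrite bt_res; tauto.
Qed.

Lemma guided_mono s s' g x : s <= s' -> guided s' (res g s') x -> guided s (res g s) x.
Proof. rewrite !guided_res. intros L H j Hj. apply H. lia. Qed.

Definition refutable_cell (a n q : nat) : Prop := refutable a (cell n q).
Definition large (a : nat) : Prop := forall n, refutable_cell a n (res p n).
Definition reservoir (n t x : nat) : Prop := guided (fs t) (sn t) x /\ pcell n x.
Definition refutable_reservoir (a n t : nat) : Prop := refutable a (reservoir n t).

(** [st] codes a condition and a cell level, [t] the length and sides of a guide. [v] codes an
    extension, a witness [z] for [e], and a level whose cell allows no further extension to refute
    [z]; that is, the refuting class is not large. *)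
Definition found (st t e v : nat) : Prop :=
  extends (fs st) (fs v) (reservoir (sn st) t) /\
  ~ refutable_cell (pr (fs v) (pr e (fs (sn v)))) (sn (sn v)) (res p (sn (sn v))).
Definition question (st t e : nat) : Prop := exists v, found st t e v.

Notation OQ := (fun _ : unit => join J1 Q).

Lemma dec_Q : dec OQ (fun _ => Q).
Proof. apply turing_le_dec, turing_le_join_r. Qed.

Lemma dec_J1 : dec OQ (fun _ => J1).
Proof. apply turing_le_dec, turing_le_join_l. Qed.

Lemma dec_M' : dec OQ (fun _ => M).
Proof.
  apply (dec_turing_le OQ M J1); [|apply dec_J1].
  apply turing_le_trans with (jump (join emptyset M)); auto.
  apply turing_le_trans with (join emptyset M);
    [apply turing_le_join_r|apply turing_le_jump_self].
Qed.

Lemma dec_p : dec OQ (fun _ => p).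
Proof. destruct p_col as [c ->]. unfold col. pose proof dec_Q. ct. Qed.

(** [J2] answers existential questions over [J1] and [Q] because [Q] is low over [J1]. *)
Lemma dec_J2_ex (A : nat -> nat -> Prop) :
  dec OQ (fun _ u => A (fs u) (sn u)) ->
  dec (fun _ : unit => J2) (fun _ x => exists n, A x n).
Proof.
  intros H. apply (dec_jump_ex _ (fun _ => A)) in H.
  apply (dec_trans_const tt _ _ _ H). now apply turing_le_dec.
Qed.

Lemma dec_J2 (A : nat -> Prop) : dec OQ (fun _ => A) -> dec (fun _ : unit => J2) (fun _ =>
    A).
Proof.
  intros H. apply (dec_ext _ (fun _ x => exists n : nat, A x)).
  { intros. split; [intros [_ ?]; auto|]. intros; exists 0; auto. }
  apply (dec_J2_ex (fun x _ => A x)). ct.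
Qed.

(** Refutation inside a cell is Sigma01 relative to [M], hence decided by [J1]. This saves the
    quantifier that keeps [large] and [question] within reach of [J2]. *)
Lemma dec_refutable_cell : dec OQ (fun _ u => refutable_cell (fs u) (fs (sn u)) (sn (sn
    u))).
Proof.
  refine (dec_trans_const tt (fun _ : unit => J1) OQ
            (fun _ u => refutable_cell (fs u) (fs (sn u)) (sn (sn u))) _ dec_J1).
  unfold refutable_cell, refutable. pose proof dec_M.
  apply (dec_J1_ex (fun u w => extends (fs (fs u)) w (cell (fs (sn u)) (sn (sn u))) /\
     refutes (fs (sn (fs u))) (sn (sn (fs u))) (fs w) (bt (sn w)))).
  apply (dec_refutable_matrix _ (fun _ u => cell (fs (sn (fs u))) (sn (sn (fs u)))) (fun _
      u => fs (fs u)));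
    unfold cell; ct.
Qed.

Lemma dec_reservoir : dec OQ (fun _ u => reservoir (fs u) (fs (sn u)) (sn (sn u))).
Proof.
  pose proof dec_M'. pose proof dec_Q. pose proof dec_p. unfold reservoir, guided, cell. ct.
Qed.

Lemma dec_large : dec (fun _ : unit => J2) (fun _ => large).
Proof.
  apply (dec_ext _ (fun _ a => ~ exists n, ~ refutable_cell a n (res p n))).
  { intros. split.
    - intros H n. apply NNPP. eauto.
    - intros H [n N]. auto. }
  apply dec_not. apply (dec_J2_ex (fun a n => ~ refutable_cell a n (res p n))).
  pose proof dec_refutable_cell. pose proof dec_p. ct.
Qed.

Lemma dec_refutable_reservoir : dec (fun _ : unit => J2) (fun _ u => refutable_reservoir
    (fs u) (fs (sn u)) (sn (sn u))).
Proof.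
  unfold refutable_reservoir, refutable.
  apply (dec_J2_ex (fun u w => extends (fs (fs u)) w (reservoir (fs (sn u)) (sn (sn u))) /\
     refutes (fs (sn (fs u))) (sn (sn (fs u))) (fs w) (bt (sn w)))).
  pose proof dec_reservoir.
  apply (dec_refutable_matrix _ (fun _ u => reservoir (fs (sn (fs u))) (sn (sn (fs u))))
      (fun _ u => fs (fs u)));
    ct.
Qed.

Lemma dec_found : dec OQ (fun _ u =>
  found (fs (fs u)) (fs (sn (fs u))) (sn (sn (fs u))) (sn u)).
Proof.
  pose proof dec_reservoir. pose proof dec_refutable_cell. pose proof dec_p. unfold found.
      ct.
  apply (dec_extends _ (fun _ u => reservoir (sn (fs (fs u))) (fs (sn (fs u))))); ct.
Qed.

Lemma dec_question : dec (fun _ : unit => J2)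
  (fun _ u => question (fs u) (fs (sn u)) (sn (sn u))).
Proof. apply (dec_J2_ex (fun u v => found (fs u) (fs (sn u)) (sn (sn u)) v)), dec_found.
    Qed.

(** * Existence of a good guide *)

Lemma bounded_max (f : nat -> nat) K : exists N, forall h, h < K -> f h <= N.
Proof.
  induction K as [|K [N HN]].
  - exists 0. intros; lia.
  - exists (N + f K). intros h Hh. destruct (Nat.eq_dec h K) as [->|]; [lia|].
    specialize (HN h). lia.
Qed.

(* If the level [s] of the tree of [guide_exists] were empty, the columns of [Q] would
   split [pcell n] into [2 ^ s] pieces, none of which belongs to its class
   [refutable a] with [large a].  Such a splitting is then coded in [M], and one of its
   pieces contains some [pcell n']. *)
Lemma splitting s :
  exists g, forall a n, large a -> refutable_reservoir a n (pr s (res g s)).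
Proof.
  apply NNPP. intros N.
  assert (K : forall h, exists an, large (fs an) /\
            ~ refutable (fs an) (fun x => (forall j, j < s -> (Q (pr j x) <-> bt h j)) /\
                pcell (sn an) x)).
  { intros h. apply NNPP. intros N'. apply N. exists (bt h). intros a n Ha.
    apply NNPP. intros N2. apply N'. exists (pr a n). rewrite fs_pr, sn_pr.
    split; auto. intros HU. apply N2. revert HU. unfold refutable_reservoir. apply
        refutable_mono.
    intros x [H1 H2]. split; auto. rewrite fs_pr, sn_pr. now apply guided_res. }
  set (f := fun h => epsilon (inhabits 0) (fun an => large (fs an) /\
    ~ refutable (fs an) (fun x => (forall j, j < s -> (Q (pr j x) <-> bt h j)) /\ pcell (sn
        an) x))).
  assert (Hf : forall h, large (fs (f h)) /\ ~ refutable (fs (f h)) (fun x =>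
            (forall j, j < s -> (Q (pr j x) <-> bt h j)) /\ pcell (sn (f h)) x)).
  { intros h. unfold f. apply epsilon_spec, K. }
  (* A level [n] whose cell lies inside the cells of all [2 ^ s] failing pieces. *)
  destruct (bounded_max (fun h => sn (f h)) (2 ^ s)) as [n Hn].
  set (O := fun SF : set * set => join emptyset (join (fst SF) (snd SF))).
  destruct (cpt_table O (fun h => fs (f h)) (2 ^ s)) as [a [Ha Ea]].
  set (piece := fun (S F : set) h x => (forall j, j < s -> (F (pr j x) <-> bt h j)) /\
     forall j, j < n -> (S (pr (fs j) (pr (sn j) x)) <-> bt (res p n) j)).
  (* The class of splittings [F] all of whose pieces of [pcell n] fail. From column [n] on,
     [below M c] contains every column needed to describe [pcell n]. *)
  destruct (M_closed (fun SF u => fs u < 2 ^ s /\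
     (extends (fs (a (fs u))) (sn u) (piece (fst SF) (snd SF) (fs u)) /\
      refutes (fs (sn (a (fs u)))) (sn (sn (a (fs u)))) (fs (sn u)) (bt (sn (sn u))))))
    with (N := n) as [c [Hc Hc']].
  - destruct (dec_pair_oracles emptyset) as [_ [H2 H3]]. fold O in H2, H3.
    apply dec_and; [ct|].
    apply (dec_refutable_matrix O (fun SF u => piece (fst SF) (snd SF) (fs u))
             (fun _ u => a (fs u)));
      unfold piece; generalize (res p n); intros k; ct.
  (* The columns of [Q] give such a splitting, so the class is nonempty, although [Q] is out of
     reach of [M]. *)
  - intros c Hc. exists Q. intros u [Hu H]. destruct (Hf (fs u)) as [_ H'].
    apply H'. rewrite Ea in H by auto. exists (sn u). destruct H as [HE HT]. split; auto.
    revert HE. apply extends_mono. intros x [H1 H2]. split; auto.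
    apply pcell_mono with n; [auto|]. intros j Hj. specialize (H2 j Hj).
    cbn [fst] in H2. unfold below in H2. rewrite fs_pr in H2. rewrite <- H2.
    pose proof (pr_ge_l (fs j) (sn j)) as L. rewrite pr_fs_sn in L. intuition lia.
  (* [h] is the piece selected by [p] from the splitting coded in column [c]. The cell of level
     [n + S m] is contained in it. *)
  - set (h := res (fun j => p (pr c j)) s).
    assert (Hh : h < 2 ^ s) by apply res_lt.
    destruct (bounded_max (fun j => pr c j) s) as [m Hm].
    destruct (Hf h) as [H1 _]. destruct (H1 (n + S m)) as [w [HE HT]].
    apply (Hc' (pr h w)). rewrite fs_pr, sn_pr, Ea by auto. split; auto. split; auto.
    revert HE. apply extends_mono. intros x Hx. unfold piece. split.
    + intros j Hj. unfold col, h. rewrite bt_res. rewrite cell_res in Hx.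
      specialize (Hx (pr c j)). rewrite fs_pr, sn_pr in Hx. rewrite Hx; [tauto|].
      specialize (Hm j Hj). lia.
    + intros j Hj. apply pcell_mono with (n := n) in Hx; [|lia].
      rewrite <- (Hx j Hj). cbn [fst]. unfold below. rewrite fs_pr.
      pose proof (pr_ge_l (fs j) (sn j)) as L. rewrite pr_fs_sn in L. intuition lia.
Qed.

Definition bad_guide (g : set) (u : nat) : Prop :=
  large (fs u) /\
  ~ refutable_reservoir (fs u) (fs (sn u)) (pr (sn (sn u)) (res g (sn (sn u)))).

(** Reservoirs shrink as the guide gets longer, so compactness turns the guides of [splitting] for
    each length into one guide for all lengths. *)
Lemma guide_exists : exists g, forall u, ~ bad_guide g u.
Proof.
  destruct (koenig (fun s g => forall a n, large a -> refutable_reservoir a n (pr s (res g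
      s)))) as [g Hg].
  - intros m g g' E H a n. rewrite <- (res_agree _ _ _ E). auto.
  - intros m g H a n Ha. generalize (H a n Ha). apply refutable_mono.
    intros x [H1 H2]. split; auto. rewrite fs_pr, sn_pr in *.
    apply guided_mono with (S m); auto.
  - apply splitting.
  - exists g. intros u [H1 H2]. apply H2. now apply Hg.
Qed.

Lemma dec_bad_guide : dec (fun g => join J2 g) bad_guide.
Proof.
  set (O := fun g => join J2 g).
  assert (H1 : dec O (fun _ => J2)).
  { apply (dec_join_l O (fun _ => J2) (fun g => g)), dec_self. }
  assert (H2 : dec O (fun g x => g x)).
  { apply (dec_join_r O (fun _ => J2) (fun g => g)), dec_self. }
  pose proof (dec_trans_const tt _ O _ dec_large H1) as H3.
  pose proof (dec_trans_const tt _ O _ dec_refutable_reservoir H1) as H4.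
  cbv beta in H3, H4. unfold bad_guide. ct.
Qed.

(** * One step of the construction *)

Definition advance (st t s : nat) : nat :=
  if excluded_middle_informative (question st t (fs s))
  then let v := least (fun v => question st t (fs s) -> found st t (fs s) v) in
       (* The sum bounds both the old level and the one found, so the cell shrinks into both. *)
       pr (fs v) (sn st + sn (sn v))
  else pr (least (fun w => refutable_reservoir (pr (fs st) s) (sn st) t ->
                    extends (fs st) w (reservoir (sn st) t) /\
                    refutes (fs s) (sn s) (fs w) (bt (sn w))))
          (sn st).

(** Both searches range over implications whose premises [J2] decides, so they end on every input,
    even for a [t] that comes from no good guide. *)
Lemma cpt_advance :
  cpt (fun _ : unit => J2) (fun _ u => advance (fs u) (fs (sn u)) (sn (sn u))).
Proof.
  pose proof dec_question. pose proof (dec_J2 _ dec_found) as Hf.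
  pose proof (dec_J2 _ dec_reservoir). pose proof dec_refutable_reservoir.
  unfold advance. cbv zeta.
  assert (L1 : cpt (fun _ : unit => J2) (fun _ u =>
    least (fun v => question (fs u) (fs (sn u)) (fs (sn (sn u))) ->
                    found (fs u) (fs (sn u)) (fs (sn (sn u))) v))).
  { apply (cpt_least _ (fun _ u v => question (fs u) (fs (sn u)) (fs (sn (sn u))) ->
                    found (fs u) (fs (sn u)) (fs (sn (sn u))) v)).
    - ct.
      apply (dec_ext _ (fun _ x => (fun u => found (fs (fs u)) (fs (sn (fs u))) (sn (sn (fs
          u))) (sn u))
         (pr (pr (fs (fs x)) (pr (fs (sn (fs x))) (fs (sn (sn (fs x)))))) (sn x)))).
      { intros. cbv beta. now rewrite ?fs_pr, ?sn_pr, ?fs_pr, ?sn_pr, ?fs_pr. }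
      apply (dec_comp _ _ (fun _ x => pr (pr (fs (fs x)) (pr (fs (sn (fs x))) (fs (sn (sn
          (fs x)))))) (sn x)) Hf).
      ct.
    - intros _ x. destruct (classic (question (fs x) (fs (sn x)) (fs (sn (sn x)))))
        as [[v Hv]|N]; [exists v; auto|exists 0; tauto]. }
  assert (L2 : cpt (fun _ : unit => J2) (fun _ u =>
    least (fun w => refutable_reservoir (pr (fs (fs u)) (sn (sn u))) (sn (fs u)) (fs (sn
        u)) ->
                    extends (fs (fs u)) w (reservoir (sn (fs u)) (fs (sn u))) /\
                    refutes (fs (sn (sn u))) (sn (sn (sn u))) (fs w) (bt (sn w))))).
  { apply (cpt_least _ (fun _ u w => refutable_reservoir (pr (fs (fs u)) (sn (sn u))) (sn
      (fs u)) (fs (sn u)) ->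
                    extends (fs (fs u)) w (reservoir (sn (fs u)) (fs (sn u))) /\
                    refutes (fs (sn (sn u))) (sn (sn (sn u))) (fs w) (bt (sn w)))).
    - ct.
      + apply (dec_extends _ (fun _ u => reservoir (sn (fs (fs u))) (fs (sn (fs u))))); ct.
      + apply (dec_refutes _ (fun _ u => bt (sn (sn u)))); ct.
    - intros _ x. destruct (classic (refutable_reservoir (pr (fs (fs x)) (sn (sn x))) (sn
        (fs x)) (fs (sn x))))
        as [K|N]; [|exists 0; tauto].
      pose proof K as [w Hw]. exists w. rewrite ?sn_pr, ?fs_pr in Hw. auto. }
  ct.
Qed.

(** * The run along a good guide *)

Section Guided.

Variable g : set.
Hypothesis g_good : forall u, ~ bad_guide g u.

Definition tag (s : nat) : nat := pr s (res g s).

(** Step [s] treats index [fs s] with witness [sn s], starting from the empty condition. The tag of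
    [S s] puts column [s] of [Q] in force from this step on. *)
Definition state (s : nat) : nat :=
  nat_rect (fun _ => nat) (pr (pr 0 0) 0) (fun s st => advance st (tag (S s)) s) s.

Notation cond s := (fs (state s)).
Notation lvl s := (sn (state s)).
Notation len s := (fs (fs (state s))).
Notation bits s := (bt (sn (fs (state s)))).

Lemma guide_refutable a n s : large a -> refutable_reservoir a n (tag s).
Proof.
  intros Ha. apply NNPP. intros N. apply (g_good (pr a (pr n s))).
  unfold bad_guide. now rewrite ?fs_pr, ?sn_pr, ?fs_pr, ?sn_pr.
Qed.

Lemma state_S s : state (S s) = advance (state s) (tag (S s)) s.
Proof. reflexivity. Qed.

Lemma advance_yes s : question (state s) (tag (S s)) (fs s) ->
  exists v, found (state s) (tag (S s)) (fs s) v /\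
    cond (S s) = fs v /\ lvl (S s) = lvl s + sn (sn v).
Proof.
  intros Hq. rewrite state_S. unfold advance.
  destruct excluded_middle_informative as [_|]; [|contradiction]. cbv zeta.
  match goal with |- context [least ?A] =>
    exists (least A); assert (exists v, A v) as E by (destruct Hq as [v Hv]; eauto);
    destruct (least_spec A E) as [HL _]
  end.
  rewrite fs_pr, sn_pr. auto.
Qed.

(** After a negative answer even the trivial extension can be refuted in every cell along [p]. So
    the class is large, and the good guide provides a refutation inside the reservoir. *)
Lemma advance_no s : ~ question (state s) (tag (S s)) (fs s) ->
  extends (cond s) (cond (S s)) (reservoir (lvl s) (tag (S s))) /\
  refutes (fs s) (sn s) (len (S s)) (bits (S s)) /\ lvl (S s) = lvl s.
Proof.
  intros Hq. rewrite state_S. unfold advance.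
  destruct excluded_middle_informative as [|_]; [contradiction|].
  assert (HX : refutable_reservoir (pr (cond s) s) (lvl s) (tag (S s))).
  { apply guide_refutable. intros n. apply NNPP. intros N. apply Hq.
    exists (pr (cond s) (pr (sn s) n)). split; rewrite ?fs_pr, ?sn_pr, ?fs_pr, ?sn_pr.
    - apply extends_refl.
    - now rewrite pr_fs_sn. }
  match goal with |- context [least ?A] => assert (exists v, A v) as E end.
  { pose proof HX as [w Hw]. rewrite fs_pr, sn_pr in Hw. eauto. }
  destruct (least_spec _ E) as [HL _]. rewrite fs_pr, sn_pr.
  destruct (HL HX). auto.
Qed.

Lemma step_extends s : extends (cond s) (cond (S s)) (reservoir (lvl s) (tag (S s))).
Proof.
  destruct (classic (question (state s) (tag (S s)) (fs s))) as [H|H].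
  - apply advance_yes in H as [v [[H _] [-> _]]]. exact H.
  - now apply advance_no in H.
Qed.

Lemma lvl_mono s s' : s <= s' -> lvl s <= lvl s'.
Proof.
  induction 1 as [|s' _ IH]; auto.
  destruct (classic (question (state s') (tag (S s')) (fs s'))) as [H|H].
  - apply advance_yes in H as [v [_ [_ ->]]]. lia.
  - apply advance_no in H as [_ [_ ->]]. lia.
Qed.

Lemma reservoir_mono n n' s s' x :
  n <= n' -> s <= s' -> reservoir n' (tag s') x -> reservoir n (tag s) x.
Proof.
  unfold reservoir, tag. rewrite ?fs_pr, ?sn_pr. intros H1 H2 [A B].
  split; [now apply guided_mono with s'|now apply pcell_mono with n'].
Qed.

Lemma run_extends s s' : s <= s' -> extends (cond s) (cond s') (reservoir (lvl s) (tag (S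
    s))).
Proof.
  induction 1 as [|s' L IH]; [apply extends_refl|].
  eapply extends_trans; [exact IH|]. eapply extends_mono; [|apply step_extends].
  intros x. apply reservoir_mono; [now apply lvl_mono|lia].
Qed.

(** * The generic set: infinite, cohesive, with controlled double jump *)

Definition generic_set : set := fun x => exists s, x < len s /\ bits s x.

Lemma generic_set_bits s x : x < len s -> (generic_set x <-> bits s x).
Proof.
  intros Hx. split; [|intros; exists s; auto]. intros [s' [H1 H2]].
  destruct (Nat.le_ge_cases s s') as [L|L]; apply run_extends in L as [_ [L _]].
  - now apply L.
  - now apply L in H2.
Qed.

(** Elements beyond [len s] enter at step [s] or later, from reservoirs inside that of step [s]. *)
Lemma generic_set_reservoir s x : len s <= x -> generic_set x -> reservoir (lvl s) (tag (S
    s)) x.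
Proof.
  intros H [s' [H1 H2]]. destruct (Nat.le_ge_cases s s') as [L|L].
  - apply run_extends in L as [_ [_ L]]. now apply L.
  - apply run_extends in L as [L _]. lia.
Qed.

(** The cells along [p] are unbounded, so one more element refutes any claimed bound. *)
Lemma question_0 st t : ~ question st t 0.
Proof.
  intros [v [_ H]]. apply H. clear H. set (n := sn (sn v)). set (w := fs v).
  destruct (p_inf n (fs w + fs (sn v))) as [x [Hx HY]].
  set (F := fun y => (y < fs w /\ bt (sn w) y) \/ y = x).
  exists (pr (S x) (res F (S x))). rewrite ?fs_pr, ?sn_pr, ?fs_pr, ?sn_pr.
  split.
  - unfold extends. rewrite fs_pr, sn_pr. split; [lia|]. split.
    + intros y Hy. rewrite bt_res. unfold F. intuition lia.
    + intros y Hy L. rewrite bt_res. intros [_ [[? _]| ->]]; [lia|auto].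
  - left. split; auto. exists x. split; auto. split; [lia|].
    apply bt_res. split; auto. now right.
Qed.

Lemma generic_set_infinite z : exists x, z <= x /\ generic_set x.
Proof.
  destruct (advance_no (pr 0 z)) as [_ [H _]].
  { rewrite fs_pr. apply question_0. }
  rewrite fs_pr, sn_pr in H. destruct H as [[_ [x [H1 [H2 H3]]]]|[? _]]; [|lia].
  exists x. split; auto. exists (S (pr 0 z)). auto.
Qed.

Lemma len_unbounded x : exists s, x < len s.
Proof.
  destruct (generic_set_infinite x) as [y [H [s [H1 _]]]]. exists s. lia.
Qed.

(** If [R] is column [c] of [Q], then from [len c] on all elements lie on the side [g c]. *)
Lemma generic_set_cohesive R : turing_le R J1 -> subset_star generic_set R \/ subset_star
    generic_set (compl R).
Proof.
  intros HR. apply Q_columns in HR as [c <-].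
  destruct (classic (g c)) as [G|G]; [left|right]; exists (len c); intros x L HC;
    destruct (generic_set_reservoir c x L HC) as [H _]; unfold tag in H;
    rewrite fs_pr, sn_pr, guided_res in H; specialize (H c (Nat.lt_succ_diag_r c));
    unfold compl, col; tauto.
Qed.

Definition answer (e : nat) : Prop :=
  question (state (pr (S e) 0)) (tag (S (pr (S e) 0))) (S e).

(** A negative answer at the first step for [S e] persists, as conditions extend and reservoirs
    shrink; so every witness [z] is refuted in turn. A positive answer gives a [z] that no extension
    inside some cell refutes, and all later elements lie in that cell. *)
Lemma generic_set_jump_jump e : jump (jump generic_set) e <-> answer e.
Proof.
  rewrite jump_jump_refutes. unfold answer. set (s0 := pr (S e) 0).
  assert (fs s0 = S e) as E0 by apply fs_pr. split.
  - intros [z Hz]. apply NNPP. intros N. set (s := pr (S e) z).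
    assert (fs s = S e) as E by apply fs_pr.
    assert (s0 <= s) as L by (apply pr_mono_r; lia).
    destruct (advance_no s) as [_ [H _]].
    { rewrite E. intros [v [H1 H2]]. apply N. exists v. split; auto.
      apply extends_trans with (cond s); [exact (run_extends s0 s L)|]. revert H1. apply
          extends_mono.
      intros x. apply reservoir_mono; [now apply lvl_mono|lia]. }
    rewrite E in H. replace (sn s) with z in H by (symmetry; apply sn_pr).
    apply (Hz (len (S s))). revert H. apply refutes_agree.
    intros x Hx. symmetry. now apply generic_set_bits.
  - intros H. rewrite <- E0 in H. apply advance_yes in H as [v [[_ H] [Ec El]]].
    rewrite E0 in H. exists (fs (sn v)). intros l HT. apply H.
    (* Adding [len (S s0)] makes the initial segment long enough to extend the condition. *)
    set (l1 := l + len (S s0)).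
    exists (pr l1 (res generic_set l1)). rewrite ?fs_pr, ?sn_pr, ?fs_pr, ?sn_pr. split.
    + rewrite <- Ec. unfold extends. rewrite fs_pr, sn_pr. split; [lia|]. split.
      * intros x Hx. rewrite bt_res. rewrite <- (generic_set_bits (S s0)) by auto.
          intuition lia.
      * intros x Hx L. rewrite bt_res. intros [_ HC].
        destruct (generic_set_reservoir (S s0) x L HC) as [_ HY]. eapply pcell_mono;
            [|exact HY]. lia.
    + apply refutes_agree with generic_set.
      * intros x Hx. rewrite bt_res. tauto.
      * apply refutes_mono with l; auto. lia.
Qed.

(** [J2] computes [advance], [g] supplies the tags, and a number is decided at the first state
    longer than it. *)
Lemma generic_set_le (B : set) : turing_le g B -> turing_le J2 B -> turing_le generic_set B.
Proof.
  intros Hg HJ. apply turing_le_dec in Hg, HJ. apply turing_le_dec.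
  set (O := fun _ : unit => B) in *.
  pose proof (cpt_trans _ O _ (fun _ => tt) cpt_advance HJ) as Hadv. cbv beta in Hadv.
  assert (Hst : cpt O (fun _ s => state s)).
  { apply (cpt_rec O (fun _ s => s) (fun _ _ => pr (pr 0 0) 0)
             (fun _ _ s st => advance st (tag (S s)) s)); ct.
    unfold tag. ct. }
  apply (dec_ext O (fun _ x => bits (least (fun s => x < len s)) x)).
  { intros _ x. symmetry. apply generic_set_bits.
    now destruct (least_spec _ (len_unbounded x)). }
  assert (cpt O (fun _ x => least (fun s => x < len s))).
  { apply (cpt_least O (fun _ x s => x < len s)); [ct|]. intros _. apply len_unbounded. }
  ct.
Qed.

(** The run is recovered without [g]: state [s] and the set reveal the side of column [s], which
    gives the tag needed for state [S s]. Then [J2] decides the [question] behind [answer]. *)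
Lemma generic_set_double_jump_le : turing_le (jump (jump generic_set)) (join generic_set
    J2).
Proof.
  apply turing_le_dec. set (O := fun _ : unit => join generic_set J2).
  assert (HC : dec O (fun _ => generic_set)).
  { exact (proj1 (turing_le_dec _ _) (turing_le_join_l generic_set J2)). }
  assert (HJ : dec O (fun _ => J2)).
  { exact (proj1 (turing_le_dec _ _) (turing_le_join_r generic_set J2)). }
  pose proof (dec_trans_const tt _ O _ (dec_J2 _ dec_Q) HJ) as HQ.
  pose proof (cpt_trans _ O _ (fun _ => tt) cpt_advance HJ) as Hadv. cbv beta in Hadv.
  pose proof (dec_trans_const tt _ O _ dec_question HJ) as Hq.
  cbv beta in HQ, Hq.
  (* [g s] is the column-[s] membership of the first element of [generic_set] beyond [len
      s]. *)
  set (next := fun st => least (fun x => fs (fs st) <= x /\ generic_set x)).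
  assert (Hnext : cpt O (fun _ st => next st)).
  { apply (cpt_least O (fun _ st x => fs (fs st) <= x /\ generic_set x)); [ct|].
    intros _ st. apply generic_set_infinite. }
  set (grow := fun s h x => if excluded_middle_informative (Q (pr s x))
                            then h + 2 ^ s else h).
  assert (Hgrow : cpt O (fun _ u => grow (fs u) (fs (sn u)) (sn (sn u)))).
  { unfold grow. ct. }
  (* [u] pairs the part of the guide below [s] with the state [s]. *)
  set (step := fun s u => let h := grow s (fs u) (next (sn u)) in
                          pr h (advance (sn u) (pr (S s) h) s)).
  set (run := fun s => nat_rect (fun _ => nat) (pr 0 (pr (pr 0 0) 0)) step s).
  assert (Hrun : cpt O (fun _ s => run s)).
  { apply (cpt_rec O (fun _ s => s) (fun _ _ => pr 0 (pr (pr 0 0) 0)) (fun _ _ => step));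
      unfold step; cbv zeta; ct. }
  assert (Hstep : forall s, grow s (res g s) (next (state s)) = res g (S s)).
  { intros s. destruct (least_spec (fun x => len s <= x /\ generic_set x)) as [[L HL] _].
    { apply generic_set_infinite. }
    fold (next (state s)) in *. destruct (generic_set_reservoir s _ L HL) as [H _]. unfold
        tag in H.
    rewrite fs_pr, sn_pr, guided_res in H. specialize (H s (Nat.lt_succ_diag_r s)).
    unfold grow. simpl. do 2 destruct excluded_middle_informative; tauto. }
  assert (Erun : forall s, run s = pr (res g s) (state s)).
  { induction s; auto. change (run (S s)) with (step s (run s)). rewrite IHs.
    unfold step. cbv zeta. now rewrite fs_pr, sn_pr, Hstep. }
  apply (dec_ext O (fun _ e => question (sn (run (pr (S e) 0)))
           (pr (S (pr (S e) 0))
               (grow (pr (S e) 0) (fs (run (pr (S e) 0))) (next (sn (run (pr (S e) 0))))))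
           (S e))).
  { intros _ e. rewrite generic_set_jump_jump. unfold answer, tag.
    rewrite Erun, fs_pr, sn_pr, Hstep. tauto. }
  ct.
Qed.

End Guided.
End Construction.

(** * Assembling the set from a degree [P] *)

Theorem mainTheorem1 :
  forall P : set, PA_rel P (jump (jump emptyset)) ->
    exists C : set,
      infinite C /\
      (forall R : set, turing_le R (jump emptyset) ->
         subset_star C R \/ subset_star C (compl R)) /\
      turing_le (jump (jump C)) (join C (jump (jump emptyset))) /\
      turing_le (join C (jump (jump emptyset))) P.
Proof.
  intros P HP.
  assert (PA : forall A : set -> nat -> Prop, dec (fun X => join J2 X) A ->
            (exists X, forall n, ~ A X n) ->
            exists X, (forall n, ~ A X n) /\ turing_le X P).
  { intros A HA [X HX].
    destruct (semidecidable_prog (fun X => join J2 X) (fun X _ n => A X n)) as [q Hq];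
      [ct|].
    destruct (HP q) as [X' [H1 H2]].
    - exists X. intros H. apply Hq in H as [n H]. now apply (HX n).
    - exists X'. split; auto. intros n Hn. apply H1. apply Hq. eauto. }
  assert (HJ : turing_le J2 P).
  { destruct (PA (fun X n => ~ (X n <-> J2 n))) as [X [H1 H2]].
    - set (O := fun X => join J2 X).
      assert (dec O (fun _ => J2)).
      { apply (dec_join_l O (fun _ => J2) (fun X => X)), dec_self. }
      assert (dec O (fun X x => X x)).
      { apply (dec_join_r O (fun _ => J2) (fun X => X)), dec_self. }
      ct.
    - exists J2. tauto.
    - replace J2 with X; auto. apply set_ext. intros n. apply NNPP, H1. }
  destruct (low_closed_set emptyset) as [M [M_low M_closed]].
  destruct (low_closed_set J1) as [Q [Q_low Q_closed]].
  destruct (ultrafilter_exists M Q M_low Q_closed) as [p [p_col p_inf]].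
  (* [P] computes a good guide; the steps along it need only [J2] in addition. *)
  destruct (PA (bad_guide M Q p)) as [g [Hg HgP]].
  { now apply dec_bad_guide. }
  { now apply guide_exists. }
  assert (HC : turing_le (generic_set M Q p g) P) by (apply generic_set_le; auto).
  exists (generic_set M Q p g). split; [|split; [|split]].
  - intros n. now apply generic_set_infinite.
  - intros R. now apply generic_set_cohesive.
  - now apply generic_set_double_jump_le.
  - now apply turing_le_join.
Qed.
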